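(* Let $k\geqslant 2$ be an integer. Then $$\delta^{\mathrm{cent}}_{\Gamma_{2k,2k-1}}(n)\asymp \delta^{\mathrm{cent}}_{\Gamma_{2k+1,2k}}(n)\asymp n^{2k-1}.$$ Hence the Dehn function and the centralized Dehn function of $\Gamma_{2k+1,2k}$ have different growth exponents.
   Context: For $p\geqslant 3$, $\Lambda_p=\mathbf Z^{p-1}\rtimes\mathbf Z$ is the group generated by $x_1,\dots,x_p$ with relations $[x_1,x_i]=x_{i+1}$ for $2\leqslant i\leqslant p-1$, $[x_i,x_j]=1$ for $2\leqslant i,j\leqslant p$, and $x_p$ central. For $3\leqslant q\leqslant p$, $\Gamma_{p,q}$ is the central product of $\Lambda_p$ and $\Lambda_q$, i.e. the quotient of $\Lambda_p\times\Lambda_q$ obtained by identifying the central generator $x_p$ of $\Lambda_p$ with the last (central) generator of $\Lambda_q$. Let $\langle S\mid R\rangle$ be a finite presentation of a group $G$ and $\mathfrak R$ the normal subgroup of the free group $F_S$ generated by $R$. A word $w\in F_S$ is null-homotopic if it represents $1$ in $G$. $\mathrm{Area}(w)$ is the minimal $k$ such that $w=\prod_{i=1}^k u_i^{-1}r_iu_i$ in $F_S$ with $u_i\in F_S$, $r_i\in R^{\pm1}$; $\mathrm{Area}^{\mathrm{cent}}(w)$ is the minimal $k$ such that $w=\prod_{i=1}^k r_i$ in $\mathfrak R/[F_S,\mathfrak R]$ with $r_i\in R^{\pm1}$. The Dehn function $\delta_G(n)$, resp. the centralized Dehn function $\delta_G^{\mathrm{cent}}(n)$, is the supremum of $\mathrm{Area}(w)$,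 resp. $\mathrm{Area}^{\mathrm{cent}}(w)$, over null-homotopic words $w$ of length at most $n$; the asymptotic behaviour does not depend on the finite presentation. For functions $f,g$ on $\mathbf Z_{\geqslant 0}$, $f\preccurlyeq g$ means $|f(n)|\leqslant A|g(An+A)|+A$ for some $A\geqslant 0$ and all $n$, and $f\asymp g$ means $f\preccurlyeq g\preccurlyeq f$. *)

(* Defs.v *)
From HB Require Import structures.
From mathcomp Require Import all_boot all_order all_algebra.
From mathcomp Require Import generic_quotient.
From mathcomp Require Import all_classical all_reals all_analysis.

Set Implicit Arguments.
Unset Strict Implicit.
Unset Printing Implicit Defensive.

Import Order.TTheory GRing.Theory Num.Theory.

Local Open Scope quotient_scope.
Local Open Scope classical_set_scope.
Local Open Scope group_scope.

Definition is_subgroup (G : groupType) (H : set G) : Prop :=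
  H 1 /\ forall x y, H x -> H y -> H (x^-1 * y).

Definition is_normal (G : groupType) (H : set G) : Prop :=
  is_subgroup H /\ forall x y, H x -> H (x ^ y).

Definition gen_subgroup (G : groupType) (A : set G) : set G :=
  smallest (@is_subgroup G) A.

Definition normal_closure (G : groupType) (A : set G) : set G :=
  smallest (@is_normal G) A.

Definition comm_subgroup (G : groupType) (H K : set G) : set G :=
  gen_subgroup [set g | exists x y, [/\ H x, K y & g = [~ x, y]]].

Lemma normal_closure_normal (G : groupType) (A : set G) :
  is_normal (normal_closure A).
Proof.
split; [split|].
- by move=> H [] [] [].
- move=> x y Hx Hy H HA; have := HA => -[] [] [_ HM] _ _.
  by apply: HM; [apply: Hx|apply: Hy].
- move=> x y Hx H HA; have := HA => -[] [_ HJ] _.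
  by apply: HJ; apply: Hx.
Qed.

Section NormalTheory.
Variables (G : groupType) (N : set G).
Hypothesis nN : is_normal N.

Lemma normal1 : N 1. Proof. by case: nN => -[]. Qed.

Lemma normalV x : N x -> N x^-1.
Proof. by case: nN => -[N1 NM] _ Nx; rewrite -[x^-1]mulg1; apply: NM. Qed.

Lemma normalM x y : N x -> N y -> N (x * y).
Proof.
by move=> /normalV Nx Ny; case: nN => -[_ NM] _; rewrite -[x]invgK; apply: NM.
Qed.

Lemma normalJ x y : N x -> N (x ^ y). Proof. by case: nN => _; apply. Qed.
End NormalTheory.

Section Quotient.
Variables (G : groupType) (A : set G).

Definition coset_eq (x y : G) : bool := `[< normal_closure A (x^-1 * y) >].

Let nA := normal_closure_normal A.

Fact coset_eq_equiv : equiv_class_of coset_eq.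
Proof.
split.
- by move=> x; apply/asboolP; rewrite mulVg; exact: normal1.
- suff sym x y : coset_eq x y -> coset_eq y x.
    by move=> x y; apply/idP/idP => /sym.
  by move/asboolP/(normalV nA); rewrite invgM invgK => ?; apply/asboolP.
- move=> y x z /asboolP xy /asboolP yz; apply/asboolP.
  by have := normalM nA xy yz; rewrite mulgA mulgK.
Qed.

Canonical coset_eq_rel := EquivRelPack coset_eq_equiv.

Definition quot : Type := {eq_quot coset_eq_rel}.
HB.instance Definition _ := Choice.on quot.

Definition quot_pi (x : G) : quot := \pi_({eq_quot coset_eq_rel}) x.
Definition quot_repr (x : quot) : G := repr (x : {eq_quot coset_eq_rel}).

Lemma quot_piP x y : quot_pi x = quot_pi y <-> normal_closure A (x^-1 * y).
Proof.
split=> [/eqmodP /asboolP //|xy]; apply/eqmodP; exact/asboolP.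
Qed.

Lemma quot_reprK x : quot_pi (quot_repr x) = x.
Proof. exact: reprK. Qed.

Definition quot_one : quot := quot_pi 1.
Definition quot_inv (x : quot) : quot := quot_pi (quot_repr x)^-1.
Definition quot_mul (x y : quot) : quot :=
  quot_pi (quot_repr x * quot_repr y).

Lemma quot_piM x y : quot_pi (x * y) = quot_mul (quot_pi x) (quot_pi y).
Proof.
apply/quot_piP; set x' := quot_repr _; set y' := quot_repr _.
have /quot_piP xx : quot_pi x = quot_pi x' by rewrite quot_reprK.
have /quot_piP yy : quot_pi y = quot_pi y' by rewrite quot_reprK.
have -> : (x * y)^-1 * (x' * y') = (x^-1 * x') ^ y * (y^-1 * y').
  by rewrite conjgE invgM !mulgA mulgK.
exact: (normalM nA (normalJ nA _ xx) yy).
Qed.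

Lemma quot_piV x : quot_pi x^-1 = quot_inv (quot_pi x).
Proof.
apply/quot_piP; set x' := quot_repr _.
have /quot_piP xx : quot_pi x = quot_pi x' by rewrite quot_reprK.
have -> : x^-1^-1 * x'^-1 = ((x^-1 * x') ^ x^-1)^-1.
  by rewrite conjgE !invgM !invgK !mulgA mulgK.
exact: (normalV nA (normalJ nA _ xx)).
Qed.

Fact quot_mulA : associative quot_mul.
Proof.
move=> x y z; rewrite -(quot_reprK x) -(quot_reprK y) -(quot_reprK z).
by rewrite -!quot_piM mulgA.
Qed.
Fact quot_mul1 : left_id quot_one quot_mul.
Proof. by move=> x; rewrite -(quot_reprK x) -quot_piM mul1g. Qed.
Fact quot_mulr1 : right_id quot_one quot_mul.
Proof. by move=> x; rewrite -(quot_reprK x) -quot_piM mulg1. Qed.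
Fact quot_mulV : left_inverse quot_one quot_inv quot_mul.
Proof. by move=> x; rewrite -(quot_reprK x) -quot_piV -quot_piM mulVg. Qed.
Fact quot_mulrV : right_inverse quot_one quot_inv quot_mul.
Proof. by move=> x; rewrite -(quot_reprK x) -quot_piV -quot_piM mulgV. Qed.

HB.instance Definition _ := isGroup.Build quot
  quot_mulA quot_mul1 quot_mulr1 quot_mulV quot_mulrV.
HB.instance Definition _ := isMultiplicative.Build G quot quot_pi quot_piM.
End Quotient.

(* The letter (s, false) stands for s and (s, true) for its inverse. *)
Definition letter (S : Type) : Type := (S * bool)%type.

Section FreeGroup.
Variable S : choiceType.

Definition inv_letter (a : letter S) : letter S := (a.1, ~~ a.2).

Definition push (a : letter S) (w : seq (S * bool)) : seq (S * bool) :=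
  if w is b :: w' then if b == inv_letter a then w' else a :: w else [:: a].

Definition reduce (w : seq (S * bool)) : seq (S * bool) := foldr push [::] w.

Fixpoint reduced (w : seq (S * bool)) : bool :=
  if w is a :: w' then
    (if w' is b :: _ then b != inv_letter a else true) && reduced w'
  else true.

Record free_group : Type := FreeGroup {
  free_word :> seq (S * bool);
  free_wordP : reduced free_word }.

HB.instance Definition _ := [isSub for free_word].
HB.instance Definition _ := [Choice of free_group by <:].

Lemma inv_letterK : involutive inv_letter.
Proof. by case=> s b; rewrite /inv_letter /= negbK. Qed.

Lemma push_reduced a w : reduced w -> reduced (push a w).
Proof.
case: w => [//|b w] /= /andP[bw rw]; case: ifP => [_ //|/negbT ba] /=.
by rewrite ba bw rw.
Qed.

Lemma foldr_push_reduced s w : reduced s -> reduced (foldr push s w).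
Proof. by move=> rs; elim: w => //= a w; apply: push_reduced. Qed.

Lemma reduce_reduced w : reduced (reduce w).
Proof. exact: foldr_push_reduced. Qed.

Lemma pushK a s : reduced s -> push (inv_letter a) (push a s) = s.
Proof.
case: s => [_|b s] /=; first by rewrite inv_letterK eqxx.
case: eqP => [-> |_ _] /=; last by rewrite inv_letterK eqxx.
case: s => [//|c s] /= /andP[/negbTE ca _].
by rewrite ca.
Qed.

Lemma foldr_push_push a w s : reduced s ->
  foldr push s (push a w) = push a (foldr push s w).
Proof.
move=> rs; case: w => [//|b w] /=; case: eqP => [-> |//].
have := pushK (inv_letter a) (foldr_push_reduced w rs).
by rewrite inv_letterK => ->.
Qed.

Lemma foldr_push_reduce w s : reduced s ->
  foldr push s (reduce w) = foldr push s w.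
Proof.
by move=> rs; elim: w => //= a w IH; rewrite foldr_push_push // -IH.
Qed.

Lemma reduce_cat u v : reduce (u ++ v) = foldr push (reduce v) u.
Proof. by rewrite /reduce foldr_cat. Qed.

Lemma reduce_id w : reduced w -> reduce w = w.
Proof.
elim: w => //= a w IH /andP[aw rw]; rewrite /reduce /= -/(reduce w) IH //.
by case: w aw {IH rw} => //= b w /negbTE ->.
Qed.

Definition inv_word (w : seq (S * bool)) : seq (S * bool) :=
  rev (map inv_letter w).

Lemma inv_wordK : involutive inv_word.
Proof.
move=> w; rewrite /inv_word map_rev revK -map_comp.
by rewrite (eq_map inv_letterK) map_id.
Qed.

Lemma reduce_invl w s : reduced s ->
  foldr push (foldr push s w) (inv_word w) = s.
Proof.
move=> rs; rewrite /inv_word; elim: w => //= a w IH.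
rewrite rev_cons -cats1 foldr_cat /= pushK ?IH //.
exact: foldr_push_reduced.
Qed.

Definition free_of_word (w : seq (S * bool)) : free_group :=
  FreeGroup (reduce_reduced w).

Definition free_one : free_group := free_of_word [::].
Definition free_mul (u v : free_group) : free_group := free_of_word (u ++ v).
Definition free_inv (u : free_group) : free_group :=
  free_of_word (inv_word u).

Fact free_mulA : associative free_mul.
Proof.
move=> u v w; apply: val_inj => /=.
rewrite reduce_cat (reduce_id (reduce_reduced _)) reduce_cat -foldr_cat.
by rewrite [in RHS]reduce_cat foldr_push_reduce ?reduce_reduced.
Qed.

Fact free_mul1 : left_id free_one free_mul.
Proof. by case=> u ru; apply: val_inj; rewrite /= reduce_id. Qed.

Fact free_mulr1 : right_id free_one free_mul.
Proof. by case=> u ru; apply: val_inj; rewrite /= cats0 reduce_id. Qed.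

Fact free_mulV : left_inverse free_one free_inv free_mul.
Proof.
case=> u ru; apply: val_inj => /=.
rewrite reduce_cat (foldr_push_reduce _ (reduce_reduced u)).
by rewrite /reduce reduce_invl.
Qed.

Fact free_mulrV : right_inverse free_one free_inv free_mul.
Proof.
case=> u ru; apply: val_inj => /=.
rewrite reduce_cat (reduce_id (reduce_reduced _)) -reduce_cat.
by rewrite -{1}[u]inv_wordK reduce_cat /reduce reduce_invl.
Qed.

HB.instance Definition _ := isGroup.Build free_group
  free_mulA free_mul1 free_mulr1 free_mulV free_mulrV.

Definition free_gen (s : S) : free_group := free_of_word [:: (s, false)].
End FreeGroup.

Definition presents (S : finType) (R : seq (free_group S)) (G : groupType) :
    Prop :=
  exists pi : {multiplicative free_group S -> G},
    (forall g, exists w, pi w = g) /\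
    (forall w, pi w = 1 <-> normal_closure [set` R] w).

Lemma presents_quot (S : finType) (R : seq (free_group S)) :
  presents R (quot [set` R]).
Proof.
exists (@quot_pi _ [set` R]); split=> [g|w].
  by exists (quot_repr g); exact: quot_reprK.
split=> [w1|Rw].
  by have /quot_piP := esym w1; rewrite invg1 mul1g.
by apply/esym/quot_piP; rewrite invg1 mul1g.
Qed.

Section Dehn.
Variables (S : finType) (R : seq (free_group S)).
Local Notation F := (free_group S).

Definition relators : set F := normal_closure [set` R].

Definition sym_relator (r : F) : Prop := r \in R \/ r^-1 \in R.

Definition has_area (w : F) (k : nat) : Prop :=
  exists u r : 'I_k -> F,
    (forall i, sym_relator (r i)) /\ w = \prod_(i < k) (r i ^ u i).

(* Equality in relators / [F, relators] is spelled out on representatives. *)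
Definition has_cent_area (w : F) (k : nat) : Prop :=
  exists r : 'I_k -> F,
    (forall i, sym_relator (r i)) /\
    comm_subgroup [set: F] relators (w^-1 * \prod_(i < k) r i).

(* Junk value 0 when P has no element; this never occurs for the (centralized)
   area of a null-homotopic word. *)
Definition least (P : nat -> Prop) : nat :=
  if pselect (exists k, `[< P k >]) is left exP then ex_minn exP else 0%N.

Definition area (w : F) : nat := least (has_area w).
Definition cent_area (w : F) : nat := least (has_cent_area w).

(* S being finite, the suprema over words of length at most n are maxima. *)
Definition dehn (n : nat) : nat :=
  \max_(w : n.-bseq (S * bool) | `[< relators (free_of_word w) >])
    area (free_of_word w).

Definition cent_dehn (n : nat) : nat :=
  \max_(w : n.-bseq (S * bool) | `[< relators (free_of_word w) >])
    cent_area (free_of_word w).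
End Dehn.

(* The generator x_i is indexed by the ordinal i - 1. *)
Definition Lambda_rel (p : nat) : set (free_group 'I_p) :=
  [set g | exists i j k : 'I_p,
      [/\ i = 0%N :> nat, (1 <= j)%N, k = j.+1 :> nat &
          g = [~ free_gen i, free_gen j] * (free_gen k)^-1]] `|`
  [set g | exists i j : 'I_p,
      [/\ (1 <= i)%N, (1 <= j)%N & g = [~ free_gen i, free_gen j]]] `|`
  [set g | exists i j : 'I_p,
      i.+1 = p /\ g = [~ free_gen i, free_gen j]].

Definition Lambda (p : nat) : groupType := quot (@Lambda_rel p).

Definition Lambda_gen (p : nat) (i : 'I_p) : Lambda p :=
  quot_pi (@Lambda_rel p) (free_gen i).

Definition Gamma_rel (p q : nat) : set (Lambda p * Lambda q)%type :=
  [set g | exists (i : 'I_p) (j : 'I_q),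
      [/\ i.+1 = p, j.+1 = q & g = (Lambda_gen i, (Lambda_gen j)^-1)]].

Definition Gamma (p q : nat) : groupType := quot (@Gamma_rel p q).

Local Open Scope ring_scope.

Section Growth.
Variable R : realType.
Implicit Types f g : nat -> R.

(* The constant A is an integer because A * n + A is an argument of g. *)
Definition preceq f g : Prop :=
  exists A : nat, forall n : nat,
    `|f n| <= A%:R * `|g (A * n + A)%N| + A%:R.

Definition asymp f g : Prop := preceq f g /\ preceq g f.

(* Infimum of the a >= 0 such that f is asymptotically at most n ^ a;
   it is +oo if there is no such a. *)
Definition growth_exponent f : \bar R :=
  ereal_inf [set a%:E | a in
    [set a : R | 0 <= a /\ preceq f (fun n => n%:R `^ a)]].
End Growth.

(* Main.v *)
(* The centralised area of a null-homotopic word is the norm of its class in the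
   central subgroup N/[F,N] of the central extension Q = F/[F,N] of Gamma.

   Upper bound: lift x_1, x_2, y_1, y_2 to Q and put x_(i+1) = [x_1,x_i] there.
   Since x_p and y_q agree up to a central element and are commutators, x_p still
   commutes with all x_i in Q.  The central elements [x_i,x_j], i, j >= 2, are
   invariant under conjugation by x_1, which forces them to vanish for
   i + j >= p+2, and, by antisymmetry, also for i + j = p+1 when p is odd.
   Collecting a word of length n then costs O(n^(2k-1)).

   Lower bound: a shift-invariant form on polynomials of odd degree d = 2k-3,
   skew on the pair (binom(x,d), 1), gives a central extension of a quotient of
   Gamma in which [x_2^n, [x_1^n, ..., [x_1^n, x_2^n]]] is central and of size
   n^(2k-1).

   Dehn function of Gamma_(2k+1,2k): in the semidirect product of Z with the
   functions Z -> Z, taken modulo the bounded functions, send x_1 to the shift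
   and x_2 to a truncated binomial.  Then x_p is the bounded function 1_(x>=0)
   and the null-homotopic word [x_1^m, [x_1^n, ..., [x_1^n, x_2^n]]] has sup norm
   about n^(2k), whereas conjugates of relators have bounded sup norm. *)
Require Import Defs.
From HB Require Import structures.
From mathcomp Require Import all_boot all_order all_algebra.
From mathcomp Require Import all_classical all_reals all_analysis.
From mathcomp Require Import zify ring.

Set Implicit Arguments.
Unset Strict Implicit.
Unset Printing Implicit Defensive.

Import Order.TTheory GRing.Theory Num.Theory.

Local Open Scope classical_set_scope.
Local Open Scope group_scope.

(** * Subgroups, quotients and free groups *)

Section Subgroups.
Variable G : groupType.
Implicit Types (H N : set G) (x y : G).

(** In the shifted indices used below, V_i = [fil x v i] is x_(i+2), with p = e + 2 and q = e' + 2.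
    A word of length n collects to an exponent of order n^(i+1) on V_i. Each further letter forces
    exchanges of V_i with V_j that cost about n^(i+j+1). Since [V_i, V_j] = 1 for i + j >= d, this
    is at most n^d per letter and n^(d+1) in all. The value d = 2k-2 serves both groups: it is e for
    Gamma_(2k,2k-1), and e - 1 for Gamma_(2k+1,2k), where e is odd and antisymmetry gains one. The
    obstacle is the exponent of x_p, of order n^(e+1), which is n^(2k) in the second group. In a
    null-homotopic word it cancels against the exponent of y_q, which is only of order n^(e'+1), so
    the central discrepancy between x_p and y_q in Q occurs O(n^(2k-1)) times. The word that makes
    the Dehn function larger is invisible to the centralised area: x_p commutes with x_1 in Q, so
    the word is trivial there. *)

Lemma is_subgroup_intro H : H 1 -> (forall x y, H x -> H y -> H (x * y)) ->
  (forall x, H x -> H x^-1) -> is_subgroup H.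
Proof. by move=> H1 HM HV; split=> // x y Hx Hy; apply: HM => //; apply: HV. Qed.

Section Closed.
Variable H : set G.
Hypothesis sH : is_subgroup H.

Lemma subgroup1 : H 1. Proof. by case: sH. Qed.
Lemma subgroupV x : H x -> H x^-1.
Proof. by case: sH => H1 HM Hx; rewrite -[x^-1]mulg1; apply: HM. Qed.
Lemma subgroupM x y : H x -> H y -> H (x * y).
Proof. by move=> /subgroupV Hx Hy; case: sH => _ HM; rewrite -[x]invgK; apply: HM. Qed.
Lemma subgroupR x y : H x -> H y -> H [~ x, y].
Proof.
move=> Hx Hy; rewrite /commg.
by apply: subgroupM; [exact: subgroupV|apply: subgroupM; [exact: subgroupV|exact: subgroupM]].
Qed.
Lemma subgroup_prod I (r : seq I) (P : pred I) (F : I -> G) :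
  (forall i, P i -> H (F i)) -> H (\prod_(i <- r | P i) F i).
Proof. by move=> HF; elim/big_ind: _ => //; [exact: subgroup1|exact: subgroupM]. Qed.
End Closed.

Lemma gen_subgroup_subgroup (A : set G) : is_subgroup (gen_subgroup A).
Proof.
split=> [K [[]]//|x y Hx Hy K HK].
by case: (HK) => -[_ KM] _; apply: KM; [apply: Hx|apply: Hy].
Qed.

Lemma gen_subgroup_sub (A : set G) x : A x -> gen_subgroup A x.
Proof. by move=> Ax K [_]; apply. Qed.

Lemma gen_subgroup_ind (A H : set G) : is_subgroup H -> A `<=` H ->
  gen_subgroup A `<=` H.
Proof. by move=> sH AH x; apply. Qed.

Lemma normal_closure_sub (A : set G) x : A x -> normal_closure A x.
Proof. by move=> Ax K [_]; apply. Qed.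

Lemma normal_closure_ind (A N : set G) : is_normal N -> A `<=` N ->
  normal_closure A `<=` N.
Proof. by move=> nN AN x; apply. Qed.

Lemma normal_closure_id N : is_normal N -> normal_closure N = N.
Proof.
by move=> nN; apply/seteqP; split=> [|x /normal_closure_sub//]; exact: normal_closure_ind.
Qed.

Lemma normal_comm_subgroup N : is_normal N -> is_normal (comm_subgroup [set: G] N).
Proof.
move=> nN; split=> [|x y]; first exact: gen_subgroup_subgroup.
suff: comm_subgroup [set: G] N `<=` [set x | forall z, comm_subgroup [set: G] N (x ^ z)].
  by move=> H /H /= Hx; exact: Hx.
have sC := gen_subgroup_subgroup [set g | exists x y, [/\ [set: G] x, N y & g = [~ x, y]]].
apply: (gen_subgroup_ind (A := [set g | exists x y, [/\ [set: G] x, N y & g = [~ x, y]]])) =>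
  [|_ [u [v [_ Nv ->]]] z].
  apply: is_subgroup_intro => [z|u v Hu Hv z|u Hu z] /=.
  - by rewrite conj1g; exact: (subgroup1 sC).
  - by rewrite conjMg; apply: (subgroupM sC); [exact: Hu|exact: Hv].
  - by rewrite conjVg; apply: (subgroupV sC); exact: Hu.
apply: gen_subgroup_sub; exists (u ^ z), (v ^ z); split=> //; last exact: conjRg.
exact: normalJ.
Qed.
End Subgroups.

Section Morphisms.
Variables (G H : groupType) (f : {multiplicative G -> H}).

Lemma mult1 : f 1 = 1.
Proof. by apply: (mulgI (f 1)); rewrite -gmulfM !mulg1. Qed.
Lemma multV x : f x^-1 = (f x)^-1.
Proof. by apply: (mulgI (f x)); rewrite -gmulfM !mulgV mult1. Qed.
Lemma multJ x y : f (x ^ y) = f x ^ f y.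
Proof. by rewrite /conjg !gmulfM multV. Qed.
Lemma multR x y : f [~ x, y] = [~ f x, f y].
Proof. by rewrite /commg /conjg !gmulfM !multV. Qed.
Lemma multX x n : f (x ^+ n) = f x ^+ n.
Proof. by elim: n => [|n IH]; rewrite ?mult1 // !expgS gmulfM IH. Qed.
Lemma mult_prod I (r : seq I) (P : pred I) (F : I -> G) :
  f (\prod_(i <- r | P i) F i) = \prod_(i <- r | P i) f (F i).
Proof. by elim/big_rec2: _ => [|i x y _ <-]; rewrite ?mult1 ?gmulfM. Qed.
End Morphisms.

Lemma preimage_normal (G H : groupType) (f : {multiplicative G -> H}) (N : set H) :
  is_normal N -> is_normal (f @^-1` N).
Proof.
move=> nN; split; last by move=> x y /= Nx; rewrite multJ; exact: normalJ.
apply: is_subgroup_intro => [|x y|x] /=.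
- by rewrite mult1; exact: normal1.
- by rewrite gmulfM; exact: normalM.
- by rewrite multV; exact: normalV.
Qed.

Lemma is_normal1 (G : groupType) : is_normal [set (1 : G)].
Proof.
split; first by apply: is_subgroup_intro => //= [x y -> ->|x ->]; rewrite ?mulg1 ?invg1.
by move=> x y /= ->; rewrite conj1g.
Qed.

Section QuotLift.
Variables (G H : groupType) (A : set G) (f : {multiplicative G -> H}).
Hypothesis fA : forall a, A a -> f a = 1.

Definition quot_lift_fun (x : quot A) : H := f (quot_repr x).

Lemma quot_lift_pi x : quot_lift_fun (quot_pi A x) = f x.
Proof.
have /quot_piP : quot_pi A x = quot_pi A (quot_repr (quot_pi A x)) by rewrite quot_reprK.
rewrite /quot_lift_fun => /(normal_closure_ind (preimage_normal f (is_normal1 H))) /=.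
move=> /(_ fA) /=; rewrite gmulfM multV => e.
by apply: (mulgI (f x)^-1); rewrite e mulVg.
Qed.

Lemma quot_lift_morph : {morph quot_lift_fun : x y / x * y}.
Proof.
move=> x y; rewrite -(quot_reprK x) -(quot_reprK y) -gmulfM !quot_lift_pi.
exact: gmulfM.
Qed.
HB.instance Definition _ := isMultiplicative.Build (quot A) H quot_lift_fun quot_lift_morph.

Lemma quot_lift : exists g : {multiplicative quot A -> H}, forall x, g (quot_pi A x) = f x.
Proof. by exists quot_lift_fun; exact: quot_lift_pi. Qed.
End QuotLift.

Lemma quot_pi1P (G : groupType) (A : set G) x : quot_pi A x = 1 <-> normal_closure A x.
Proof.
have -> : (1 : quot A) = quot_pi A 1 by rewrite mult1.
rewrite quot_piP mulg1; split=> [|]; last exact: (normalV (normal_closure_normal A)).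
by move=> /(normalV (normal_closure_normal A)); rewrite invgK.
Qed.

Section FreeLift.
Variables (S : choiceType) (H : groupType).

Definition lval (f : S -> H) (a : S * bool) : H := if a.2 then (f a.1)^-1 else f a.1.
Definition wval (f : S -> H) (w : seq (S * bool)) : H := \prod_(a <- w) lval f a.

Lemma wval_cat f u v : wval f (u ++ v) = wval f u * wval f v.
Proof. by rewrite /wval big_cat. Qed.
Lemma wval_cons f a v : wval f (a :: v) = lval f a * wval f v.
Proof. by rewrite /wval big_cons. Qed.
Lemma wval_nil f : wval f [::] = 1.
Proof. by rewrite /wval big_nil. Qed.

Lemma wval_reduce f w : wval f (reduce w) = wval f w.
Proof.
elim: w => //= a w IH; rewrite wval_cons -IH /reduce /= -/(reduce w).
case: (reduce w) => [|b v] /=; first by rewrite wval_cons.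
case: ifP => [/eqP->|_]; last by rewrite [LHS]wval_cons.
by rewrite wval_cons /lval /=; case: a => s [] /=; rewrite mulgA ?mulVg ?mulgV ?mul1g.
Qed.

Definition free_lift_fun (f : S -> H) (u : free_group S) : H := wval f u.

Lemma free_lift_morph f : {morph free_lift_fun f : x y / x * y}.
Proof. by move=> x y; rewrite /free_lift_fun /= wval_reduce wval_cat. Qed.
HB.instance Definition _ f :=
  isMultiplicative.Build (free_group S) H (free_lift_fun f) (free_lift_morph f).

Lemma free_lift (f : S -> H) :
  exists g : {multiplicative free_group S -> H}, forall s, g (free_gen s) = f s.
Proof.
exists (free_lift_fun f) => s; change (wval f [:: (s, false)] = f s).
by rewrite wval_cons wval_nil mulg1.
Qed.
End FreeLift.

Lemma free_of_word_cat (S : choiceType) (u v : seq (S * bool)) :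
  free_of_word (u ++ v) = free_of_word u * free_of_word v.
Proof.
apply: val_inj; change (reduce (u ++ v) = reduce (reduce u ++ reduce v)).
by rewrite !reduce_cat (reduce_id (reduce_reduced v)) foldr_push_reduce ?reduce_reduced.
Qed.

Lemma free_of_word_letter (S : choiceType) (a : S * bool) :
  free_of_word [:: a] = lval (@free_gen S) a.
Proof. by case: a => s [] //; apply: val_inj. Qed.

Lemma free_of_word_cons (S : choiceType) a (w : seq (S * bool)) :
  free_of_word (a :: w) = lval (@free_gen S) a * free_of_word w.
Proof. by rewrite -cat1s free_of_word_cat free_of_word_letter. Qed.

Lemma free_of_wordE (S : choiceType) (w : seq (S * bool)) :
  free_of_word w = wval (@free_gen S) w.
Proof.
elim: w => [|a w IH]; first by rewrite wval_nil.
by rewrite free_of_word_cons IH wval_cons.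
Qed.

Lemma gmulf_wval (S : choiceType) (G H : groupType) (f : {multiplicative G -> H})
    (g : S -> G) w : f (wval g w) = wval (f \o g) w.
Proof.
elim: w => [|a w IH]; first by rewrite !wval_nil mult1.
by rewrite !wval_cons gmulfM IH /lval /=; case: a.2 => //=; rewrite multV.
Qed.

Lemma free_wordK (S : choiceType) (u : free_group S) : free_of_word u = u.
Proof. by apply: val_inj; rewrite /= reduce_id //; case: u. Qed.

Lemma free_group_gen (S : choiceType) (K : set (free_group S)) : is_subgroup K ->
  (forall s, K (free_gen s)) -> forall u, K u.
Proof.
move=> sK Kg u; rewrite -[u]free_wordK free_of_wordE.
by apply: subgroup_prod => // -[s []] _; rewrite /lval //=; apply: subgroupV.
Qed.

(** * Integer powers *)

Definition zexp (G : groupType) (x : G) (z : int) : G :=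
  match z with Posz n => x ^+ n | Negz n => x ^- n.+1 end.

Section IntegerPowers.
Variable G : groupType.
Implicit Types (x y : G) (m n : int).

Lemma zexp0 x : zexp x 0 = 1. Proof. by []. Qed.
Lemma zexpNn x (k : nat) : zexp x (- k%:Z)%R = x ^- k.
Proof. by case: k => [|k]; rewrite ?oppr0 /= ?invg1. Qed.

Lemma zexpS x n : zexp x (n + 1)%R = zexp x n * x.
Proof.
elim/int_rec: n => [|n _|n _]; first by rewrite add0r mul1g.
  by rewrite -PoszD addn1 /= expgSr.
rewrite -addn1 PoszD opprD -addrA addNr addr0 -opprD -PoszD addn1 !zexpNn.
by rewrite expgS invgM mulgVK.
Qed.

Lemma zexpB1 x n : zexp x (n - 1)%R = zexp x n * x^-1.
Proof. by rewrite -{2}(subrK 1%R n) zexpS mulgK. Qed.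

Lemma zexpD x m n : zexp x (m + n)%R = zexp x m * zexp x n.
Proof.
elim/int_rec: n => [|n IH|n IH]; first by rewrite addr0 mulg1.
  by rewrite -addn1 PoszD addrA !zexpS IH mulgA.
by rewrite -addn1 PoszD opprD addrA !zexpB1 IH mulgA.
Qed.

Lemma zexpN x n : zexp x (- n)%R = (zexp x n)^-1.
Proof. by apply: (mulgI (zexp x n)); rewrite -zexpD subrr mulgV. Qed.

Lemma zexpV x n : zexp x^-1 n = (zexp x n)^-1.
Proof. by case: n => n /=; rewrite expVgn. Qed.

Lemma zexp1g n : zexp 1 n = 1 :> G.
Proof. by case: n => n /=; rewrite expg1n ?invg1. Qed.

Lemma commute_zexp x y n : commute x y -> commute x (zexp y n).
Proof. by case: n => n c /=; [|apply: commuteV]; apply: commuteX. Qed.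

Lemma zexpMg x y n : commute x y -> zexp (x * y) n = zexp x n * zexp y n.
Proof.
case: n => n c /=; rewrite expgMn // invgM.
by apply/commute_sym/commuteV/commute_sym/commuteV/commuteX2.
Qed.

Lemma conjzXg x y n : zexp x n ^ y = zexp (x ^ y) n.
Proof. by case: n => n /=; rewrite ?conjVg conjXg. Qed.

End IntegerPowers.

Lemma mult_zexp (G H : groupType) (f : {multiplicative G -> H}) x n :
  f (zexp x n) = zexp (f x) n.
Proof. by case: n => n /=; rewrite ?multV multX. Qed.

(** * Computing up to central elements of bounded cost *)

(** [cost a k] reads: a is central, of size at most k. The two instances are [cent_cost], the norm
    by relators in F / [F, relators], and [heis_norm], the size of a central integer in the lower
    bound. *)
Definition is_cost (G : groupType) (cost : G -> nat -> Prop) : Prop :=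
  [/\ cost 1 0%N,
      forall a k l, cost a k -> (k <= l)%N -> cost a l,
      forall a b k l, cost a k -> cost b l -> cost (a * b) (k + l)%N,
      forall a k, cost a k -> cost a^-1 k &
      forall a k x, cost a k -> commute a x].

Section Cost.
Variables (G : groupType) (cost : G -> nat -> Prop).
Hypothesis costP : is_cost cost.

Let cost1 k : cost 1 k.
Proof. by case: costP => c1 cm _ _ _; apply: cm c1 _. Qed.
Lemma cost_mono a k l : cost a k -> (k <= l)%N -> cost a l.
Proof. by case: costP => _ cm _ _ _; apply: cm. Qed.
Let costM a b k l : cost a k -> cost b l -> cost (a * b) (k + l)%N.
Proof. by case: costP => _ _ cM _ _; apply: cM. Qed.
Let costV a k : cost a k -> cost a^-1 k.
Proof. by case: costP => _ _ _ cV _; apply: cV. Qed.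
Let costC a k x : cost a k -> commute a x.
Proof. by case: costP => _ _ _ _ cC; apply: cC. Qed.

Lemma costX a k n : cost a k -> cost (a ^+ n) (k * n)%N.
Proof.
move=> ca; elim: n => [|n IH]; first exact: cost1.
by rewrite expgS mulnS; apply: costM.
Qed.

Lemma cost_zexp a k n : cost a k -> cost (zexp a n) (k * `|n|)%N.
Proof. by case: n => n ca /=; [|apply: costV]; apply: costX. Qed.

Definition nearby k (x y : G) : Prop := exists2 a, cost a k & x = y * a.

Lemma nearby_refl x k : nearby k x x.
Proof. by exists 1; rewrite ?mulg1. Qed.

Lemma nearby_mono k l x y : nearby k x y -> (k <= l)%N -> nearby l x y.
Proof. by case=> a ca -> kl; exists a => //; apply: cost_mono kl. Qed.

Lemma nearby_sym k x y : nearby k x y -> nearby k y x.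
Proof. by case=> a ca ->; exists a^-1; rewrite ?mulgK //; apply: costV. Qed.

Lemma nearby_trans k l x y z : nearby k x y -> nearby l y z -> nearby (k + l)%N x z.
Proof.
case=> a ca -> [b cb ->]; exists (b * a); rewrite ?mulgA // addnC.
exact: costM.
Qed.

Lemma nearbyMl k x y z : nearby k x y -> nearby k (z * x) (z * y).
Proof. by case=> a ca ->; exists a; rewrite ?mulgA. Qed.

Lemma nearbyMr k x y z : nearby k x y -> nearby k (x * z) (y * z).
Proof. by case=> a ca ->; exists a => //; rewrite -!mulgA (costC z ca). Qed.

Lemma nearbyM k l x y z t : nearby k x y -> nearby l z t -> nearby (k + l)%N (x * z) (y * t).
Proof. by move=> xy zt; apply: nearby_trans (nearbyMr z xy) (nearbyMl y zt). Qed.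

Lemma nearby_prod (u v : nat -> G) (f : nat -> nat) n :
  (forall i, (i < n)%N -> nearby (f i) (u i) (v i)) ->
  nearby (\sum_(i < n) f i) (\prod_(i < n) u i) (\prod_(i < n) v i).
Proof.
elim: n => [|n IH] H; first by rewrite !big_ord0; exact: nearby_refl.
rewrite !big_ord_recr /=; apply: nearbyM; last exact: H.
by apply: IH => i ni; apply: H; apply: ltnW.
Qed.

Lemma nearby_prod_comm (u : nat -> G) (f : nat -> nat) z n :
  (forall i, (i < n)%N -> nearby (f i) (u i * z) (z * u i)) ->
  nearby (\sum_(i < n) f i) (\prod_(i < n) u i * z) (z * \prod_(i < n) u i).
Proof.
elim: n => [|n IH] H; first by rewrite !big_ord0 mulg1 mul1g; exact: nearby_refl.
rewrite !big_ord_recr /= -mulgA addnC.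
apply: nearby_trans (nearbyMl _ (H n _)) _ => //; rewrite !mulgA; apply: nearbyMr.
by apply: IH => i ni; apply: H; apply: ltnW.
Qed.

(** Exchanging the two powers takes [m * n] exchanges of single factors, each leaving one central
    factor [x, y]. *)
Lemma nearby_commX x y k m n : cost [~ x, y] k ->
  nearby (k * (m * n)) (x ^+ m * y ^+ n) (y ^+ n * x ^+ m).
Proof.
move=> c; have step j : nearby (k * j) (x * y ^+ j) (y ^+ j * x).
  elim: j => [|j IH]; first by rewrite expg0 mulg1 mul1g; apply: nearby_refl.
  rewrite !expgS !mulgA mulnS; apply: nearby_trans (_ : nearby _ _ (y * x * y ^+ j)) _.
    by apply: nearbyMr; exists [~ x, y] => //; rewrite -commgC.
  by rewrite -!mulgA; apply: nearbyMl.
elim: m => [|m IH]; first by rewrite mul1g mulg1; apply: nearby_refl.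
rewrite !expgSr -!mulgA mulSn mulnDr.
apply: nearby_trans (nearbyMl _ (step n)) _.
by rewrite !mulgA; apply: nearbyMr.
Qed.

Lemma cost_commV x y k : cost [~ x, y] k -> cost [~ x^-1, y] k.
Proof.
move=> c; have := costC x^-1 (costV c).
rewrite invgR => e; rewrite (_ : [~ x^-1, y] = [~ y, x]).
  by rewrite -invgR; apply: costV.
have e2 : [~ y, x] ^ x^-1 = [~ y, x] by rewrite conjgE e mulKg.
by rewrite -e2 /commg /conjg invgK !mulgA mulgK.
Qed.

Lemma cost_commC x y k : cost [~ x, y] k -> cost [~ y, x] k.
Proof. by move=> c; rewrite -invgR; apply: costV. Qed.

Lemma nearby_comm x y k m n : cost [~ x, y] k ->
  nearby (k * (`|m| * `|n|)) (zexp x m * zexp y n) (zexp y n * zexp x m).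
Proof.
have cV u v : cost [~ u, v] k -> cost [~ u, v^-1] k.
  by move=> /cost_commC/cost_commV/cost_commC.
by case: m n => [m|m] [n|n] c /=; rewrite -?expVgn; apply: nearby_commX => //;
  do ?[apply: cV|apply: cost_commV].
Qed.

Lemma nearby_expgMn x y k n : cost [~ x, y] k ->
  nearby (k * n ^ 2) ((x * y) ^+ n) (x ^+ n * y ^+ n).
Proof.
move=> c; elim: n => [|n IH]; first by rewrite !expg0 mulg1; apply: nearby_refl.
have h : nearby (k * (n * 1)) (y ^+ n * x) (x * y ^+ n).
  by have := nearby_commX n 1 (cost_commC c); rewrite expg1.
rewrite expgSr; apply: (@nearby_mono (k * n ^ 2 + k * (n * 1))); last first.
  by rewrite -mulnDr leq_mul2l; apply/orP; right; nia.
apply: nearby_trans (nearbyMr _ IH) _; rewrite [x ^+ n.+1]expgSr [y ^+ n.+1]expgSr.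
rewrite -!mulgA; apply: nearbyMl; rewrite !mulgA; exact: nearbyMr.
Qed.

Lemma nearbyV k x y : nearby k x y -> nearby k x^-1 y^-1.
Proof.
case=> a ca ->; exists a^-1; first exact: costV.
by rewrite [LHS](invgM y a); apply: costC (costV ca).
Qed.

Lemma nearby_zexpMg x y k n : cost [~ x, y] k ->
  nearby (k * (2 * `|n| ^ 2)) (zexp (x * y) n) (zexp x n * zexp y n).
Proof.
move=> c; case: n => n; rewrite [`|_|%N]/=.
  by apply: nearby_mono (nearby_expgMn n c) _; rewrite leq_mul2l leq_pmull ?orbT.
have := nearby_commX n.+1 n.+1 c; have := nearby_expgMn n.+1 c.
move=> h1 h2; have := nearbyV (nearby_trans h1 h2); rewrite invgM.
by rewrite -mulnDr mulnn addnn -mul2n.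
Qed.
End Cost.

(** * Collection in a filiform group *)

Definition fil (G : groupType) (x v : G) (i : nat) : G := iter i (commg x) v.

Section Collection.
Variables (G : groupType) (cost : G -> nat -> Prop).
Hypothesis costP : is_cost cost.
Variables (x v : G) (d L K : nat).
Local Notation V := (fil x v).
Hypothesis V_eventually1 : forall i, (L <= i)%N -> V i = 1.
Hypothesis costV : forall i j, cost [~ V i, V j] K.
Hypothesis commV : forall i j, (d <= i + j)%N -> [~ V i, V j] = 1.
Local Notation nearby := (nearby cost).

Definition nform (a : nat -> int) : G := \prod_(i < L) zexp (V i) (a i).

(** The effect on exponents of conjugation by x, up to central elements: V_i ^ x = V_i *
    (V_(i+1))^-1 lowers the exponent of V_(i+1) by a_i. The prefix sums [cum] invert it and serve
    for x^-1. *)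
Definition dif (a : nat -> int) (i : nat) : int :=
  (a i - (if i is j.+1 then a j else 0))%R.

Definition cum (a : nat -> int) (i : nat) : int := (\sum_(j < i.+1) a j)%R.

Lemma difK a : dif (cum a) =1 a.
Proof.
case=> [|i]; rewrite /dif /cum /=; first by rewrite subr0 big_ord1.
by rewrite big_ord_recr /= addrAC subrr add0r.
Qed.

Lemma fil_conj i : V i ^ x = V i * (V i.+1)^-1.
Proof. by rewrite /fil /= -/(fil x v i) invgR commgEl mulgA mulgV mul1g. Qed.

(** Splitting (V_i * (V_(i+1))^-1)^(a_i) produces about |a_i|^2 commutators of V_i and V_(i+1). They
    vanish unless i + (i+1) < d, and then |a_i|^2 <= n^(2i+2) <= n^d. *)
Lemma nform_conj a n : (forall i, (i < L)%N -> (`|a i| <= n ^ i.+1)%N) ->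
  nearby (L * (K * (2 * n ^ d))) (nform a ^ x) (nform (dif a)).
Proof.
move=> an.
have -> : nform a ^ x = \prod_(i < L) zexp (V i * (V i.+1)^-1) (a i).
  rewrite /nform conjg_prod; apply: eq_bigr => i _.
  by rewrite conjzXg fil_conj.
have -> : nform (dif a) = \prod_(i < L) (zexp (V i) (a i) * zexp (V i.+1) (- a i)%R).
  (* Only adjacent powers of the same V_i are merged, so this regrouping is exact; the boundary
     factor disappears because V_L = 1. *)
  rewrite /nform; have telescope l : \prod_(i < l) (zexp (V i) (a i) * zexp (V i.+1) (- a i)%R)
      = (\prod_(i < l) zexp (V i) (dif a i)) *
        zexp (V l) (if l is j.+1 then - a j else 0)%R.
    elim: l => [|l IH]; first by rewrite !big_ord0 mul1g.
    rewrite !big_ord_recr /= IH -!mulgA; congr (_ * _); rewrite mulgA -zexpD.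
    by congr (zexp _ _ * _); rewrite addrC /dif; case: (l) => [|j] //; rewrite subr0.
  by rewrite telescope V_eventually1 // zexp1g mulg1.
have -> : (L * (K * (2 * n ^ d)) = \sum_(i < L) (K * (2 * n ^ d)))%N.
  by rewrite sum_nat_const card_ord.
apply: (nearby_prod costP (u := fun i => zexp (V i * (V i.+1)^-1) (a i))
  (v := fun i => zexp (V i) (a i) * zexp (V i.+1) (- a i)%R)
  (f := fun=> (K * (2 * n ^ d))%N)) => i iL.
rewrite zexpN -zexpV.
have [le|gt] := leqP d (i + i.+1).
  rewrite zexpMg; first exact: nearby_refl.
  by apply/commuteV/commgP/eqP/commV.
have cost_comm := cost_commC costP (cost_commV costP (costV i.+1 i)).
apply: nearby_mono (nearby_zexpMg costP _ cost_comm) _ => //.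
rewrite !leq_mul2l; apply/orP; right => //=.
have [n0|n0] := posnP n.
  by move: (an i iL); rewrite n0 exp0n // leqn0 => /eqP ->.
apply: leq_trans (_ : n ^ (i.+1 * 2) <= _)%N; first by rewrite expnM leq_exp2r ?an.
by rewrite leq_pexp2l //; lia.
Qed.

Definition add0th (e : int) (a : nat -> int) (i : nat) : int :=
  (a i + (if i == 0%N then e else 0))%R.

(** The letter travels left past the powers of V_i with i > 0. Those with i >= d commute with it,
    and for the others |a_i| <= n^(i+1) <= n^d. *)
Lemma nform_mulV0 a n e : (`|e| <= 1)%N ->
  (forall i, (i < L)%N -> (`|a i| <= n ^ i.+1)%N) ->
  nearby (L * (K * (2 * n ^ d))) (nform a * zexp v e) (nform (add0th e a)).
Proof.
move=> e1 an; rewrite /nform.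
case: L V_eventually1 an => [|l] V1 an.
  by rewrite !big_ord0 -[X in zexp X e]/(V 0) V1 // zexp1g mulg1; exact: nearby_refl.
rewrite !big_ord_recl /= -mulgA.
apply: nearby_mono (_ : nearby (\sum_(i < l) (K * (2 * n ^ d))%N) _ _) _ => //; last first.
  by rewrite sum_nat_const card_ord leq_mul2r leqnSn orbT.
rewrite zexpD -mulgA; apply: nearbyMl.
have -> : \prod_(i < l) zexp (fil x v (bump 0 i)) (add0th e a (bump 0 i))
  = \prod_(i < l) zexp (V i.+1) (a i.+1).
  by apply: eq_bigr => i _; rewrite /add0th addr0.
apply: (nearby_prod_comm costP (u := fun i => zexp (V i.+1) (a i.+1))
  (f := fun=> (K * (2 * n ^ d))%N)) => i il.
have [le|gt] := leqP d (i.+1 + 0).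
  have c : commute (V i.+1) v by apply/commgP/eqP/(commV le).
  rewrite (_ : _ * _ = zexp v e * zexp (V i.+1) (a i.+1)); first exact: nearby_refl.
  by apply: commute_zexp; apply/commute_sym/commute_zexp/commute_sym.
apply: nearby_mono (nearby_comm costP _ _ (costV i.+1 0)) _ => //.
rewrite leq_mul2l; apply/orP; right.
have [n0|n0] := posnP n.
  by move: (an i.+1 il); rewrite n0 exp0n // leqn0 => /eqP ->.
apply: leq_trans (_ : n ^ i.+2 * 1 <= _)%N; first exact: leq_mul (an i.+1 il) e1.
by rewrite muln1 (leq_trans (_ : _ <= n ^ d)%N) ?leq_pmull // leq_pexp2l //; lia.
Qed.

Definition xv (b : bool) : G := if b then v else x.

(** Here m counts the letters read so far and n is the final length. With m < n, one letter raises m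
    by just one: the factor n ^ i absorbs the lower exponents, and 2 ^ i absorbs the prefix sums of
    [cum]. *)
Definition bounded_coef (n m : nat) (a : nat -> int) : Prop :=
  forall i, (`|a i| <= 2 ^ i * (m * n ^ i))%N.

Lemma bounded_coef_pow n m a : (m <= n)%N -> bounded_coef n m a ->
  forall i, (i < L)%N -> (`|a i| <= (2 * n) ^ i.+1)%N.
Proof.
move=> mn am i _; apply: leq_trans (am i) _.
by rewrite expnMn !expnS leq_mul ?leq_pmull // leq_mul2r mn orbT.
Qed.

Lemma bounded_dif n m a : (m < n)%N -> bounded_coef n m a -> bounded_coef n m.+1 (dif a).
Proof.
move=> mn am [|i]; first by have := am 0%N; rewrite /dif; lia.
apply: leq_trans (_ : `|a i.+1| + `|a i| <= _)%N; first by rewrite /dif; lia.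
have := am i.+1; have := am i; rewrite mulSn !expnS.
set u := (2 ^ i)%N; set w := (n ^ i)%N => h1 h2.
have : (m * w <= n * w)%N by rewrite leq_mul2r ltnW ?orbT.
have : (u * (m * w) <= u * (n * w))%N by rewrite leq_mul2l leq_mul2r (ltnW mn) !orbT.
by nia.
Qed.

Lemma bounded_cum n m a : (m < n)%N -> bounded_coef n m a -> bounded_coef n m.+1 (cum a).
Proof.
move=> mn am i; have n0 : (0 < n)%N by lia.
have low : (`|(\sum_(j < i) a j)%R| <= 2 ^ i * n ^ i)%N.
  elim: i => [|i IH]; first by rewrite big_ord0.
  rewrite big_ord_recr /=; set s := (\sum_(_ < _) _)%R in IH *.
  apply: leq_trans (_ : `|s| + `|a i| <= _)%N; first by lia.
  have := am i; rewrite !expnS; set u := (2 ^ i)%N in IH *; set w := (n ^ i)%N in IH *.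
  have : (u * (m * w) <= u * (n * w))%N by rewrite leq_mul2l leq_mul2r (ltnW mn) !orbT.
  have : (u * w <= u * (n * w))%N by rewrite leq_mul2l leq_pmull ?orbT.
  by nia.
rewrite /cum big_ord_recr /=; set s := (\sum_(_ < _) _)%R in low *.
apply: leq_trans (_ : `|s| + `|a i| <= _)%N; first by lia.
by have := am i; nia.
Qed.

Lemma bounded_add0th n m a e : (`|e| <= 1)%N -> (m < n)%N -> bounded_coef n m a ->
  bounded_coef n m.+1 (add0th e a).
Proof.
move=> e1 mn am [|i]; have := am 0%N; rewrite /add0th /= ?addr0; first by lia.
by move=> _; apply: leq_trans (am i.+1) _; rewrite leq_mul2l leq_mul2r leqnSn !orbT.
Qed.

(** Letters are appended on the right: v changes the exponent of V_0, while x and its inverse join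
    the leading power of x after conjugating the normal form. *)
Lemma collect n (w : seq (bool * bool)) : (size w <= n)%N ->
  exists (t : int) (a : nat -> int), bounded_coef n (size w) a /\
    nearby (size w * (L * (K * (2 * (2 * n) ^ d)))) (wval xv w) (zexp x t * nform a).
Proof.
elim/last_ind: w => [|w [b s] IH].
  exists 0%R, (fun=> 0%R); split=> [i|]; first by rewrite absz0.
  rewrite wval_nil mul1g /nform big1 //; exact: nearby_refl.
rewrite size_rcons => wn; have /IH [t [a [am nearby_a]]] := ltnW wn.
set C := (L * _)%N in nearby_a *.
rewrite -cats1 wval_cat wval_cons wval_nil mulg1 mulSn addnC.
suff [t' [a' [am' nearby_a']]] : exists t' a', bounded_coef n (size w).+1 a' /\
    nearby C (zexp x t * nform a * lval xv (b, s)) (zexp x t' * nform a').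
  by exists t', a'; split=> //; apply: nearby_trans (nearbyMr costP _ nearby_a) _.
have bnd := bounded_coef_pow (ltnW wn) am; rewrite /lval /=.
case: b => /=.
  have [e e1 ->] : exists2 e : int, (`|e| <= 1)%N & (if s then v^-1 else v) = zexp v e.
    by case: s; [exists (- 1)%R|exists 1%R].
  exists t, (add0th e a); split; first exact: bounded_add0th.
  rewrite -mulgA; apply: nearbyMl => //.
  exact: nform_mulV0.
case: s.
  exists (t - 1)%R, (cum a); split; first exact: bounded_cum.
  rewrite zexpB1 -!mulgA; apply: nearbyMl => //.
  (* Conjugation by x^-1 is conjugation by x read backwards, from [a] = [dif (cum a)] to [cum a]. *)
  have := nform_conj (bounded_coef_pow wn (bounded_cum wn am)).
  have -> : nform (dif (cum a)) = nform a.
    by apply: eq_bigr => i _; rewrite difK.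
  by move=> /(nearby_sym costP)/(nearbyMr costP x^-1); rewrite conjgE -!mulgA mulgV mulg1.
exists (t + 1)%R, (dif a); split; first exact: bounded_dif.
rewrite zexpS -!mulgA [nform a * x]conjgC; do 2 apply: nearbyMl => //.
exact: nform_conj.
Qed.
End Collection.

(** * Presentations of the filiform groups and of their central products *)

(** A presentation of Lambda_(e+2) on x = x_1 and v = x_2 alone. The last equation is [x_1, x_p] =
    1, which makes x_p central. *)
Definition filiform_rel (G : groupType) (e : nat) (x v : G) : Prop :=
  (forall i j, commute (fil x v i) (fil x v j)) /\ fil x v e.+1 = 1.

Definition central_product_rel (G : groupType) (e e' : nat) (x v y w : G) : Prop :=
  [/\ filiform_rel e x v, filiform_rel e' y w,
      commute x y /\ commute x w, commute v y /\ commute v w &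
      fil x v e = fil y w e'].

Lemma fil_mult (G H : groupType) (f : {multiplicative G -> H}) x v i :
  f (fil x v i) = fil (f x) (f v) i.
Proof. by elim: i => //= i IH; rewrite multR IH. Qed.

Lemma fil_eq1 (G : groupType) e (x v : G) i :
  fil x v e = 1 -> (e <= i)%N -> fil x v i = 1.
Proof.
move=> e1 /subnK <-; elim: (i - e)%N => //= j IH.
by rewrite -/(fil _ _ _) IH commg1.
Qed.

Lemma subgroup_centraliser (G : groupType) (y : G) : is_subgroup [set x | commute x y].
Proof.
apply: is_subgroup_intro => [|u v Hu Hv|u Hu] /=; apply/commute_sym.
- exact: commute1.
- by apply: commuteM; apply/commute_sym.
- by apply: commuteV; apply/commute_sym.
Qed.

Lemma fil_subgroup (G : groupType) (K : set G) x v : is_subgroup K -> K x -> K v ->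
  forall i, K (fil x v i).
Proof. by move=> sK Kx Kv; elim=> //= i IH; apply: subgroupR. Qed.

Section LambdaPresentation.
Variable e : nat.
Local Notation p := e.+2.
Local Notation L := (Lambda p).

Definition Lambda_x : L := Lambda_gen (ord0 : 'I_p).
Definition Lambda_v : L := Lambda_gen (lift ord0 ord0 : 'I_p).

Lemma Lambda_relation (u : free_group 'I_p) : @Lambda_rel p u -> quot_pi (@Lambda_rel p) u = 1.
Proof. by move=> ru; apply/quot_pi1P; exact: normal_closure_sub. Qed.

Lemma Lambda_genE (i : 'I_p) j : i = j.+1 :> nat -> Lambda_gen i = fil Lambda_x Lambda_v j.
Proof.
elim: j i => [|j IH] i ij.
  by congr (Lambda_gen _); apply: val_inj.
have jp : (j.+1 < p)%N by rewrite -ltnS -ij ltnW // ltnS ltn_ord.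
have /= IHj := IH (Ordinal jp) erefl; rewrite /fil /= -/(fil _ _ j) -IHj.
apply/esym/divg1_eq; rewrite /Lambda_x /Lambda_gen -multR -multV -gmulfM.
by apply: Lambda_relation; left; left; exists ord0, (Ordinal jp), i; split.
Qed.

Lemma Lambda_filiform : filiform_rel e Lambda_x Lambda_v.
Proof.
have ve1 : fil Lambda_x Lambda_v e.+1 = 1.
  rewrite /fil /= -/(fil _ _ e) -(@Lambda_genE ord_max) //.
  apply/eqP; rewrite commg1_sym; apply/eqP; rewrite -multR; apply: Lambda_relation; right.
  by exists ord_max, ord0.
split=> // i j.
have [ie|ie] := leqP e.+1 i; first by rewrite (fil_eq1 ve1 ie); apply/commute_sym/commute1.
have [je|je] := leqP e.+1 j; first by rewrite (fil_eq1 ve1 je); apply: commute1.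
have ip : (i.+1 < p)%N by []; have jp : (j.+1 < p)%N by [].
rewrite -(@Lambda_genE (Ordinal ip)) // -(@Lambda_genE (Ordinal jp)) //.
apply/commgP/eqP; rewrite -multR; apply: Lambda_relation; left; right.
by exists (Ordinal ip), (Ordinal jp).
Qed.

Lemma Lambda_generated (K : set L) : is_subgroup K -> K Lambda_x -> K Lambda_v ->
  forall g, K g.
Proof.
move=> sK Kx Kv g; rewrite -(quot_reprK g).
have sK' : is_subgroup (quot_pi (@Lambda_rel p) @^-1` K).
  apply: is_subgroup_intro => [|a b|a] /=; rewrite ?mult1 ?gmulfM ?multV.
  - exact: subgroup1.
  - exact: subgroupM.
  - exact: subgroupV.
apply: (free_group_gen sK') => i /=.
case: (posnP i) => [i0|i0].
  suff -> : i = ord0 by [].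
  exact: val_inj.
by rewrite -/(Lambda_gen i) (@Lambda_genE i i.-1) ?prednK //; exact: fil_subgroup.
Qed.

Lemma Lambda_universal (H : groupType) (x v : H) : filiform_rel e x v ->
  exists f : {multiplicative L -> H}, f Lambda_x = x /\ f Lambda_v = v.
Proof.
case=> Vcomm Ve1.
have [f0 f0E] := free_lift (fun i : 'I_p => if val i is j.+1 then fil x v j else x).
suff H0 a : @Lambda_rel p a -> f0 a = 1.
  have [f fE] := quot_lift H0; exists f; rewrite /Lambda_x /Lambda_v /Lambda_gen.
  by rewrite !fE !f0E.
have V_central (j : nat) : commute (fil x v e) (if j is j'.+1 then fil x v j' else x).
  case: j => [|j]; last exact: Vcomm.
  by apply/commute_sym/commgP/eqP.
case=> [[]|] [i [j]].
- move=> [k [i0 j1 kj ->]]; rewrite gmulfM multV multR !f0E /= i0 kj.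
  by case: j j1 {kj} => [[|j'] jp] //= _; rewrite mulgV.
- case: i j => [[|i'] ip] [[|j'] jp] [//= _ _ ->]; rewrite multR !f0E /=.
  exact/eqP/commgP/Vcomm.
move=> [ie ->]; rewrite multR !f0E; apply/eqP/commgP.
have -> : val i = e.+1 by case: ie.
exact: V_central.
Qed.
End LambdaPresentation.

Section GammaPresentation.
Variables e e' : nat.
Local Notation Ga := (Gamma e.+2 e'.+2).
Local Notation pi := (quot_pi (@Gamma_rel e.+2 e'.+2)).

Definition Gamma_x : Ga := pi (Lambda_x e, 1).
Definition Gamma_v : Ga := pi (Lambda_v e, 1).
Definition Gamma_y : Ga := pi (1, Lambda_x e').
Definition Gamma_w : Ga := pi (1, Lambda_v e').

Lemma Gamma_fil_l i : fil Gamma_x Gamma_v i = pi (fil (Lambda_x e) (Lambda_v e) i, 1).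
Proof.
elim: i => //= i IH; rewrite -!/(fil _ _ _) IH /Gamma_x -multR; congr pi.
by congr (_, _); exact: commg1.
Qed.

Lemma Gamma_fil_r i : fil Gamma_y Gamma_w i = pi (1, fil (Lambda_x e') (Lambda_v e') i).
Proof.
elim: i => //= i IH; rewrite -!/(fil _ _ _) IH /Gamma_y -multR; congr pi.
by congr (_, _); exact: commg1.
Qed.

Lemma pair_mulE (G H : groupType) (a c : G) (b d : H) :
  (a, b) * (c, d) = (a * c, b * d) :> G * H.
Proof. by []. Qed.

Lemma pair_invE (G H : groupType) (a : G) (b : H) : (a, b)^-1 = (a^-1, b^-1) :> G * H.
Proof. by []. Qed.

Lemma pair_commute (G H : groupType) (a : G) (b : H) : commute ((a, 1) : G * H) (1, b).
Proof. by rewrite /commute !pair_mulE !mulg1 !mul1g. Qed.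

Lemma Gamma_central_product :
  central_product_rel e e' Gamma_x Gamma_v Gamma_y Gamma_w.
Proof.
have [Vc V1] := Lambda_filiform e; have [Wc W1] := Lambda_filiform e'.
have pc a b : commute (pi (a, 1)) (pi (1, b)).
  exact/gmulf_commute/pair_commute.
split; try by split; exact: pc.
- split=> [i j|]; rewrite !Gamma_fil_l; last by rewrite V1; exact: mult1.
  by apply: gmulf_commute; rewrite /commute !pair_mulE !mulg1 Vc.
- split=> [i j|]; rewrite !Gamma_fil_r; last by rewrite W1; exact: mult1.
  by apply: gmulf_commute; rewrite /commute !pair_mulE !mulg1 Wc.
rewrite Gamma_fil_l Gamma_fil_r; apply/esym/quot_piP; apply: normal_closure_sub.
exists (@ord_max e.+1), (@ord_max e'.+1); split=> //.
rewrite (@Lambda_genE _ ord_max e) // (@Lambda_genE _ ord_max e') //.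
by rewrite pair_invE pair_mulE invg1 mul1g mulg1.
Qed.

Lemma pair_mull (G H : groupType) (u v : G) : (u * v, 1) = (u, 1) * (v, 1) :> G * H.
Proof. by rewrite pair_mulE mulg1. Qed.
Lemma pair_mulr (G H : groupType) (u v : H) : (1, u * v) = (1, u) * (1, v) :> G * H.
Proof. by rewrite pair_mulE mulg1. Qed.
Lemma pair_invl (G H : groupType) (u : G) : (u^-1, 1) = (u, 1)^-1 :> G * H.
Proof. by rewrite pair_invE invg1. Qed.
Lemma pair_invr (G H : groupType) (u : H) : (1, u^-1) = (1, u)^-1 :> G * H.
Proof. by rewrite pair_invE invg1. Qed.

Lemma Gamma_generated (K : set Ga) : is_subgroup K ->
  K Gamma_x -> K Gamma_v -> K Gamma_y -> K Gamma_w -> forall g, K g.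
Proof.
move=> sK Kx Kv Ky Kw g; rewrite -(quot_reprK g); case: (quot_repr g) => a b.
have -> : (a, b) = (a, 1) * (1, b) :> (Lambda _ * Lambda _)%type.
  by rewrite pair_mulE mulg1 mul1g.
rewrite gmulfM; apply: subgroupM => //.
- have sK1 : is_subgroup [set a | K (pi (a, 1))].
    apply: is_subgroup_intro => [|u v Hu Hv|u Hu] /=.
    + by rewrite mult1; exact: subgroup1.
    + by rewrite pair_mull gmulfM; exact: subgroupM.
    + by rewrite pair_invl multV; exact: subgroupV.
  exact: (Lambda_generated sK1).
- have sK1 : is_subgroup [set b | K (pi (1, b))].
    apply: is_subgroup_intro => [|u v Hu Hv|u Hu] /=.
    + by rewrite mult1; exact: subgroup1.
    + by rewrite pair_mulr gmulfM; exact: subgroupM.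
    + by rewrite pair_invr multV; exact: subgroupV.
  exact: (Lambda_generated sK1).
Qed.
End GammaPresentation.

Section PairLift.
Variables (G1 G2 H : groupType) (f : {multiplicative G1 -> H}) (g : {multiplicative G2 -> H}).
Hypothesis fg : forall a b, commute (f a) (g b).

Definition pair_lift_fun (u : G1 * G2) : H := f u.1 * g u.2.
Lemma pair_lift_morph : {morph pair_lift_fun : x y / x * y}.
Proof.
move=> [a b] [c d]; rewrite /pair_lift_fun /= !gmulfM -!mulgA; congr (_ * _).
by rewrite !mulgA (fg c b).
Qed.
HB.instance Definition _ :=
  isMultiplicative.Build (G1 * G2)%type H pair_lift_fun pair_lift_morph.

Lemma pair_lift : exists h : {multiplicative G1 * G2 -> H}, forall a b, h (a, b) = f a * g b.
Proof. by exists pair_lift_fun. Qed.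
End PairLift.

Lemma Gamma_universal e e' (H : groupType) (x v y w : H) :
  central_product_rel e e' x v y w ->
  exists f : {multiplicative Gamma e.+2 e'.+2 -> H},
    [/\ f (Gamma_x e e') = x, f (Gamma_v e e') = v,
        f (Gamma_y e e') = y & f (Gamma_w e e') = w].
Proof.
move=> [Vrel Wrel [xy xw] [vy vw] eq_z].
have [f [fx fv]] := Lambda_universal Vrel; have [g [gx gv]] := Lambda_universal Wrel.
have fg a b : commute (f a) (g b).
  have S1 (z : H) : is_subgroup [set a | commute (f a) z].
    apply: is_subgroup_intro => [|c d|c] /=; rewrite ?mult1 ?gmulfM ?multV.
    - exact: (subgroup1 (subgroup_centraliser z)).
    - exact: (subgroupM (subgroup_centraliser z)).
    - exact: (subgroupV (subgroup_centraliser z)).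
  have S2 (z : H) : is_subgroup [set b | commute z (g b)].
    apply: is_subgroup_intro => [|c d|c] /=; rewrite ?mult1 ?gmulfM ?multV.
    - exact: commute1.
    - exact: commuteM.
    - exact: commuteV.
  have {}S2 z := Lambda_generated (S2 z); rewrite /= gx gv in S2.
  by apply: (Lambda_generated (S1 (g b))) => /=; rewrite ?fx ?fv; exact: S2.
have [h hE] := pair_lift fg.
have relH a : @Gamma_rel e.+2 e'.+2 a -> h a = 1.
  case=> i [j [ie je ->]]; rewrite hE multV.
  rewrite (@Lambda_genE _ i e); last by case: ie.
  rewrite (@Lambda_genE _ j e'); last by case: je.
  by rewrite !fil_mult fx fv gx gv eq_z mulgV.
have [F FE] := quot_lift relH; exists F.
by rewrite /Gamma_x /Gamma_v /Gamma_y /Gamma_w !FE !hE !mult1 !mulg1 !mul1g.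
Qed.

(** * Central extensions of the central product *)

Section CentralCommutators.
Variable G : groupType.
Implicit Types a b c x y : G.

Definition central a : Prop := forall x, commute a x.

Lemma central_conj a x : central a -> a ^ x = a.
Proof. by move=> ca; apply/conjg_fixP/commgP/ca. Qed.

Lemma commgMl a b c : central [~ a, c] -> [~ a * b, c] = [~ a, c] * [~ b, c].
Proof.
move=> h; rewrite -(central_conj b h) /commg /conjg invgM !mulgA.
by rewrite !(mulgK, mulgVK).
Qed.

Lemma centralV a : central a -> central a^-1.
Proof. by move=> ca x; apply/commute_sym/commuteV/commute_sym. Qed.

Lemma central_commC a b : central [~ a, b] -> central [~ b, a].
Proof. by move=> /centralV; rewrite invgR. Qed.

Lemma commgMr a b c : central [~ a, b] -> [~ a, b * c] = [~ a, b] * [~ a, c].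
Proof.
move=> h; rewrite -[LHS]invgR commgMl; last exact: central_commC.
by rewrite invgM !invgR h.
Qed.

Lemma commgVl a b : central [~ a, b] -> [~ a^-1, b] = [~ a, b]^-1.
Proof.
by move=> h; apply: (mulgI [~ a, b]); rewrite -commgMl // mulgV comm1g mulgV.
Qed.

Lemma commgVr a b : central [~ a, b] -> [~ a, b^-1] = [~ a, b]^-1.
Proof.
by move=> h; apply: (mulgI [~ a, b]); rewrite -commgMr // mulgV commg1 mulgV.
Qed.

Lemma commg_centralMl c a b : central c -> [~ a * c, b] = [~ a, b].
Proof.
move=> hc; have <- : [~ a, b] ^ c = [~ a, b].
  by apply/conjg_fixP/commgP/commute_sym/hc.
by rewrite /commg /conjg invgM -!mulgA (hc b).
Qed.

Lemma commg_centralMr c a b : central c -> [~ a, b * c] = [~ a, b].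
Proof. by move=> hc; rewrite -[LHS]invgR commg_centralMl // invgR. Qed.

(** Conjugation by g multiplies a and b by central elements, which drop out of [a, b]. Applied with
    a, b in one factor and g in the other, this shows that the lift of x_p = y_q still commutes with
    the generators. *)
Lemma comm_commg1 g a b : central [~ g, a] -> central [~ g, b] -> [~ g, [~ a, b]] = 1.
Proof.
move=> /central_commC ha /central_commC hb; apply/eqP/commgP/commute_sym/commgP.
apply/eqP; rewrite commgEl conjRg.
have conjE u : u ^ g = u * [~ u, g] by rewrite commgEl mulVKg.
by rewrite !conjE commg_centralMl // commg_centralMr // mulVg.
Qed.
End CentralCommutators.

Section CommutatorForm.
Variables (G : groupType) (x v : G) (e : nat).
Local Notation V := (fil x v).
Hypothesis V_central : forall i j, central [~ V i, V j].
Hypothesis V_end_x : commute (V e) x.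
Hypothesis V_end : forall i, commute (V e) (V i).
Let alpha i j := [~ V i, V j].

Lemma fil_end1 i : (e < i)%N -> V i = 1.
Proof.
apply: fil_eq1; rewrite /= -/(fil x v e); exact/eqP/commgP/commute_sym.
Qed.

(* Conjugation by x maps V i to V i * (V i.+1)^-1 and fixes alpha i j. *)
Lemma alpha_rec i j : alpha i.+1 j * alpha i j.+1 = alpha i.+1 j.+1.
Proof.
pose U k := V k ^ x.
have VE k : V k = U k * V k.+1 by rewrite /U fil_conj mulgVK.
have UV k l : [~ U k, V l] = alpha k l * (alpha k.+1 l)^-1.
  by rewrite /U fil_conj commgMl // commgVl.
have VU k l : [~ V l, U k] = alpha l k * (alpha l k.+1)^-1.
  by rewrite /U fil_conj commgMr // commgVr.
have cV k l : central (alpha k l) by exact: V_central.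
have cVV k l : central (alpha k l)^-1 by exact/centralV/cV.
have cUV k l : central [~ U k, V l].
  by rewrite UV => z; apply/commute_sym/commuteM; apply/commute_sym; [apply: cV|apply: cVV].
have cVU k l : central [~ V l, U k] by exact: central_commC.
have UU k l : [~ U k, U l] = alpha k l by rewrite /U -conjRg central_conj.
have : alpha i j = alpha i j * (alpha i j.+1 * (alpha i.+1 j.+1)^-1) *
    (alpha i.+1 j * (alpha i.+1 j.+1)^-1 * alpha i.+1 j.+1).
  have cU : central [~ U i, U j * V j.+1].
    rewrite commgMr ?UU // => z; apply/commute_sym/commuteM; apply/commute_sym.
      exact: cV.
    exact: cUV.
  transitivity [~ U i * V i.+1, U j * V j.+1]; first by rewrite -!VE.
  by rewrite commgMl // (commgMr (a := U i)) ?UU // (commgMr (a := V i.+1)) // UV VU.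
have key (a b c d : G) : central b -> central c ->
    a = a * (b * d^-1) * (c * d^-1 * d) -> c * b = d.
  move=> cb cc; rewrite mulgVK -!mulgA -{1}[a]mulg1 => /mulgI/esym.
  by rewrite -(cc d^-1) mulgA (cb c) => /divg1_eq.
exact: key.
Qed.

Lemma alpha_end i j : (e <= i)%N || (e <= j)%N -> alpha i j = 1.
Proof.
rewrite /alpha; case/orP => h; apply/eqP/commgP; move: h; rewrite leq_eqVlt.
  case/orP => [/eqP <-|/fil_end1 ->]; first exact: V_end.
  exact/commute_sym/commute1.
case/orP => [/eqP <-|/fil_end1 ->]; last exact: commute1.
exact/commute_sym/V_end.
Qed.

(** Downward induction on the antidiagonal m = i + j. Once the next antidiagonal vanishes,
    [alpha_rec] carries the vanishing of alpha i (j+1) to alpha (i+1) j. The walk starts at j = e,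
    where V_e commutes with every V_i; for m >= 2e one of the indices is already at least e. *)
Lemma alpha_high i j : (e <= i + j)%N -> alpha i j = 1.
Proof.
suff H n m : (2 * e <= m + n)%N -> (e <= m)%N -> forall k l, (k + l)%N = m -> alpha k l = 1.
  by move=> ij; apply: (H (2 * e)%N (i + j)%N); lia.
elim: n m => [|n IH] m mn em k l klm.
  by apply: alpha_end; lia.
have step k' l' : (k' + l').+1 = m -> alpha k' l'.+1 = 1 -> alpha k'.+1 l' = 1.
  move=> km a1; have := alpha_rec k' l'; rewrite a1 mulg1 => ->.
  by apply: (IH m.+1); lia.
have [le|le] := leqP e l; first by apply: alpha_end; rewrite le orbT.
suff H r : (r <= e)%N -> alpha (m - e + r) (e - r) = 1.
  have := H (e - l)%N; rewrite (_ : m - e + (e - l) = k)%N; last by lia.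
  by rewrite (_ : e - (e - l) = l)%N; [apply|]; lia.
elim: r => [|r IHr] re; first by apply: alpha_end; rewrite subn0 leqnn orbT.
rewrite addnS; apply: step; first by lia.
by rewrite (_ : (e - r.+1).+1 = e - r)%N; [apply: IHr|]; lia.
Qed.

(* On the antidiagonal i + j = e.-1 the relation makes alpha alternate in sign
   from alpha h h = 1. *)
Lemma alpha_high_odd i j : odd e -> (e.-1 <= i + j)%N -> alpha i j = 1.
Proof.
move=> oe ij; have [le|lt] := leqP e (i + j); first exact: alpha_high.
have eE : e = e./2.*2.+1 by rewrite -[LHS]odd_double_half oe.
set h := e./2 in eE; have {ij lt} ijh : (i + j = h.*2)%N by lia.
have sym k l : alpha k l = 1 -> alpha l k = 1.
  by rewrite /alpha => a1; rewrite -invgR a1 invg1.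
have up r : (r <= h)%N -> alpha (h + r) (h - r) = 1.
  elim: r => [|r IH] rh; first by rewrite addn0 subn0 /alpha commgg.
  have := alpha_rec (h + r) (h - r.+1).
  rewrite -subSn // subSS IH ?(ltnW rh) // mulg1 addnS => ->.
  by apply: alpha_high; lia.
have [le|lt] := leqP h i.
  by have := up (i - h)%N; rewrite subnKC // (_ : h - (i - h) = j)%N; [apply|]; lia.
apply: sym; have := up (j - h)%N; rewrite subnKC; last by lia.
by rewrite (_ : h - (j - h) = i)%N; [apply|]; lia.
Qed.
End CommutatorForm.

(** * Cost of a null-homotopic word in a central extension of the central product *)

Section CentralExtension.
Variables (Q G : groupType) (p : {multiplicative Q -> G}) (cost : Q -> nat -> Prop).
Hypothesis costP : is_cost cost.
Hypothesis kernel_cost : forall a, p a = 1 -> exists k, cost a k.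
Hypothesis cost_kernel : forall a k, cost a k -> p a = 1.
Variables (e e' d : nat) (X V Y W : Q).
Hypotheses (e0 : (0 < e)%N) (e'0 : (0 < e')%N) (d0 : (0 < d)%N) (e'd : (e' <= d)%N).
(** The commutators [V_i, V_j] vanish for i + j >= d by [alpha_high], or by [alpha_high_odd] when e
    = d + 1 is odd. For the W_j the bound e' <= d gives the same. *)
Hypothesis ed : (e <= d + odd e)%N.
Hypothesis relG : central_product_rel e e' (p X) (p V) (p Y) (p W).

(** Only the sum of the two last exponents is determined, because V_e and W_e' are the same element
    of the central product. *)
Definition normal_form_unique (x v y w : G) : Prop := forall t a s b,
  zexp x t * nform x v e.+1 a * (zexp y s * nform y w e'.+1 b) = 1 ->
  [/\ t = 0%R, s = 0%R, forall i, (i < e)%N -> a i = 0%R,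
      forall j, (j < e')%N -> b j = 0%R & (a e + b e')%R = 0%R].
Hypothesis uniqG : normal_form_unique (p X) (p V) (p Y) (p W).
Local Notation nearby := (nearby cost).

Let kernel_central a : p a = 1 -> central a.
Proof. by move=> /kernel_cost [k ca] x; case: costP => _ _ _ _ H; apply: H ca. Qed.

Let commute_central a b : commute (p a) (p b) -> central [~ a, b].
Proof. by move=> c; apply: kernel_central; rewrite multR; apply/eqP/commgP. Qed.

Let Vcc i j : central [~ fil X V i, fil X V j].
Proof. by apply: commute_central; rewrite !fil_mult; case: relG => -[]. Qed.

Let Wcc i j : central [~ fil Y W i, fil Y W j].
Proof. by apply: commute_central; rewrite !fil_mult; case: relG => _ []. Qed.

Let XYc i : commute (p X) (fil (p Y) (p W) i).
Proof.
case: relG => _ _ [c1 c2] _ _; apply/commute_sym.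
by apply: (fil_subgroup (subgroup_centraliser (p X))); apply/commute_sym.
Qed.

Let VWc i j : commute (fil (p X) (p V) i) (fil (p Y) (p W) j).
Proof.
case: relG => _ _ [c1 c2] [c3 c4] _; have S := subgroup_centraliser.
apply/commute_sym/(fil_subgroup (S _ _)); apply/commute_sym.
  by apply: (fil_subgroup (S _ _)).
by apply: (fil_subgroup (S _ _)).
Qed.

Let XYcc : [/\ central [~ X, Y], central [~ X, W], central [~ V, Y] & central [~ V, W]].
Proof. by case: relG => _ _ [? ?] [? ?] _; split; apply: commute_central. Qed.

(** The relation x_p = y_q read in Q: the two lifts differ by this one central element, whose cost
    is a constant. *)
Definition amalg : Q := (fil Y W e')^-1 * fil X V e.

Let amalg1 : p amalg = 1.
Proof.
rewrite /amalg gmulfM multV !fil_mult; case: relG => _ _ _ _ ->.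
by rewrite mulVg.
Qed.

Let VeE : fil X V e = fil Y W e' * amalg.
Proof. by rewrite mulVKg. Qed.

(* fil X V e is a commutator of Y-letters up to the central element amalg. *)
Let V_end_x : commute (fil X V e) X.
Proof.
case: XYcc => c1 c2 _ _; apply/commute_sym; rewrite VeE; apply: commuteM.
  apply/commgP/eqP; rewrite -(prednK e'0) /= -/(fil Y W _); apply: comm_commg1 => //.
  by apply: commute_central; rewrite fil_mult.
exact/commute_sym/kernel_central.
Qed.

Let V_end i : commute (fil X V e) (fil X V i).
Proof.
apply/commute_sym; rewrite VeE; apply: commuteM; last exact/commute_sym/kernel_central.
apply/commgP/eqP; rewrite -(prednK e'0) /= -/(fil Y W _); apply: comm_commg1.
  apply: commute_central; rewrite fil_mult; case: relG => _ _ [c1 _] [c3 _] _.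
  exact: (fil_subgroup (subgroup_centraliser _)).
by apply: commute_central; rewrite !fil_mult.
Qed.

Let WeE : fil Y W e' = fil X V e * amalg^-1.
Proof. by rewrite /amalg invgM invgK mulVKg. Qed.

Let amalgV : central amalg^-1.
Proof. by apply/centralV/kernel_central. Qed.

Let W_end_y : commute (fil Y W e') Y.
Proof.
case: XYcc => c1 _ c3 _; apply/commute_sym; rewrite WeE; apply: commuteM.
  apply/commgP/eqP; rewrite -(prednK e0) /= -/(fil X V _); apply: comm_commg1.
    exact: central_commC.
  apply: commute_central; rewrite fil_mult; apply/commute_sym.
  by case: relG => _ _ [? ?] [? ?] _; apply: (fil_subgroup (subgroup_centraliser _)).
exact/commute_sym.
Qed.

Let W_end j : commute (fil Y W e') (fil Y W j).
Proof.
apply/commute_sym; rewrite WeE; apply: commuteM; last exact/commute_sym.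
apply/commgP/eqP; rewrite -(prednK e0) /= -/(fil X V _); apply: comm_commg1.
  by apply: commute_central; rewrite fil_mult; apply/commute_sym.
by apply: commute_central; rewrite !fil_mult; apply/commute_sym.
Qed.

Let V_comm i j : (d <= i + j)%N -> [~ fil X V i, fil X V j] = 1.
Proof.
move=> dij; case: (boolP (odd e)) ed => [oe|_] /= ed'.
  by apply: (@alpha_high_odd _ _ _ e) => //; lia.
by apply: (@alpha_high _ _ _ e) => //; lia.
Qed.

Let W_comm i j : (d <= i + j)%N -> [~ fil Y W i, fil Y W j] = 1.
Proof. by move=> dij; apply: (@alpha_high _ _ _ e') => //; exact: leq_trans dij. Qed.

Let V_end1 i : (e.+1 <= i)%N -> fil X V i = 1.
Proof. exact: fil_end1. Qed.

Let W_end1 i : (e'.+1 <= i)%N -> fil Y W i = 1.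
Proof. exact: fil_end1. Qed.

Let uniform_cost (m n : nat) (f : nat -> nat -> Q) :
  (forall i j, p (f i j) = 1) -> (forall i j, (m < i)%N || (n < j)%N -> f i j = 1) ->
  exists K, forall i j, cost (f i j) K.
Proof.
move=> pf f1; have /(_ _)/cid := fun i : 'I_m.+1 * 'I_n.+1 => kernel_cost (pf i.1 i.2).
move=> /all_sig [k kP]; exists (\sum_i k i)%N => i j.
have [im|im] := leqP i m; last first.
  by rewrite f1 ?im //; case: costP => c1 cm _ _ _; apply: cm c1 _.
have [jn|jn] := leqP j n; last first.
  by rewrite f1 ?jn ?orbT //; case: costP => c1 cm _ _ _; apply: cm c1 _.
have [] : (i < m.+1)%N /\ (j < n.+1)%N by [].
move=> im1 jn1; apply: (cost_mono costP (kP (Ordinal im1, Ordinal jn1))).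
by rewrite (bigD1 (Ordinal im1, Ordinal jn1)) //= leq_addr.
Qed.

(* Side, generator (first or second), and inverse flag of a letter. *)
Definition gens (c : bool * bool) : Q := if c.1 then xv Y W c.2 else xv X V c.2.

Definition side (c : bool) (u : seq (bool * bool * bool)) : seq (bool * bool) :=
  [seq (a.1.2, a.2) | a <- u & a.1.1 == c].

Lemma size_side c u : (size (side c u) <= size u)%N.
Proof. by rewrite size_map size_filter count_size. Qed.

Lemma nearby_wval_comm K (f : bool -> Q) z u : (forall b, cost [~ f b, z] K) ->
  nearby (K * size u)%N (wval f u * z) (z * wval f u).
Proof.
move=> h; elim: u => [|a u IH]; first by rewrite wval_nil mulg1 mul1g; exact: nearby_refl.
rewrite wval_cons mulnS addnC -mulgA; apply: nearby_trans (nearbyMl _ IH) _ => //.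
rewrite !mulgA; apply: nearbyMr => //.
have c : cost [~ lval f a, z] K.
  by rewrite /lval; case: a.2; [apply: cost_commV|apply: h].
by exists [~ lval f a, z]; rewrite // -commgC.
Qed.

Lemma nearby_separate K u :
  (forall b c, cost [~ xv Y W b, xv X V c] K) ->
  nearby (K * size u ^ 2)%N (wval gens u)
    (wval (xv X V) (side false u) * wval (xv Y W) (side true u)).
Proof.
move=> h; elim/last_ind: u => [|u a IH].
  by rewrite !wval_nil mulg1; exact: nearby_refl.
rewrite /side !filter_rcons -cats1 wval_cat [wval _ [:: a]]wval_cons wval_nil mulg1.
apply: (@nearby_mono _ _ costP (K * size u ^ 2 + K * size u)%N); last first.
  by rewrite size_cat /= -mulnDr leq_mul2l; apply/orP; right; nia.
apply: (nearby_trans costP (nearbyMr costP _ IH)).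
case: a => [[[] g] s] /=.
  rewrite map_rcons -cats1 wval_cat wval_cons wval_nil mulg1 !mulgA; exact: nearby_refl.
rewrite map_rcons -cats1 wval_cat wval_cons wval_nil mulg1 -!mulgA.
apply: nearbyMl => //; apply: (@nearby_mono _ _ costP (K * size (side true u))%N); last first.
  by rewrite leq_mul2l size_side orbT.
apply: nearby_wval_comm => b; rewrite /lval /=; case: s => //.
exact: (cost_commC costP (cost_commV costP (cost_commC costP (h b g)))).
exact: (h b g).
Qed.

(** Three costs add up. Separating the two factors takes at most n^2 exchanges, which is within
    n^(d+1) as d > 0; collecting each factor costs O(n^(d+1)). By uniqueness of the normal form,
    what then remains is a power of [amalg]. *)
Lemma central_word_cost :
  exists C, forall u, p (wval gens u) = 1 -> cost (wval gens u) (C * size u ^ d.+1).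
Proof.
have alpha_kernel x v i j : commute (fil (p x) (p v) i) (fil (p x) (p v) j) ->
    p [~ fil x v i, fil x v j] = 1.
  by move=> c; rewrite multR !fil_mult; apply/eqP/commgP.
have [K1 K1P] : exists K, forall i j, cost [~ fil X V i, fil X V j] K.
  apply: (@uniform_cost e e) => i j; first by apply: alpha_kernel; case: relG => -[].
  by case/orP => /V_end1 ->; rewrite ?comm1g ?commg1.
have [K2 K2P] : exists K, forall i j, cost [~ fil Y W i, fil Y W j] K.
  apply: (@uniform_cost e' e') => i j; first by apply: alpha_kernel; case: relG => _ [].
  by case/orP => /W_end1 ->; rewrite ?comm1g ?commg1.
have [K3 K3P] : exists K, forall b c, cost [~ xv Y W b, xv X V c] K.
  have [K KP] : exists K, forall i j : nat,
      cost (if (i < 2)%N && (j < 2)%N then [~ xv Y W (i == 1%N), xv X V (j == 1%N)] else 1) K.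
    apply: (@uniform_cost 1 1) => i j.
      case: ifP => _; rewrite ?mult1 // multR; apply/eqP/commgP/commute_sym.
      by case: relG => _ _ [? ?] [? ?] _; case: (i == 1%N); case: (j == 1%N).
    by rewrite !ltnNge => /orP[|] ->; rewrite ?andbF.
  exists K => b c; have := KP b c; by case: b; case: c.
have [K4 K4P] := kernel_cost amalg1.
pose C1 := (e.+1 * (K1 * (2 * 2 ^ d)))%N; pose C2 := (e'.+1 * (K2 * (2 * 2 ^ d)))%N.
exists (K3 + (C1 + C2) + K4 * 2 ^ e')%N => u pu1.
set n := size u.
have [n0|n0] := posnP n.
  by rewrite (size0nil n0) wval_nil; case: costP => c1 cm _ _ _; apply: cm c1 _.
have [t [a [_ near1]]] := collect costP V_end1 K1P V_comm (size_side false u).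
have [s [b [bb near2]]] := collect costP W_end1 K2P W_comm (size_side true u).
(* The exponent of [amalg] is a e = - b e'. It is bounded through the second factor, because e' <= d
   whereas e may be d + 1. *)
have bn : (`|b e'| <= 2 ^ e' * n ^ d.+1)%N.
  apply: leq_trans (bb e') _; rewrite leq_mul2l; apply/orP; right.
  apply: leq_trans (leq_mul (size_side true u) (leqnn _)) _.
  by rewrite -/n -expnS leq_pexp2l // ltnS.
have near3 := nearby_separate u K3P; rewrite -/n in near1 near2 near3.
have := nearby_trans costP near3 (nearbyM costP near1 near2).
set k := (_ + _)%N; case=> c cc uE.
have k_le : (k <= (K3 + (C1 + C2)) * n ^ d.+1)%N.
  rewrite /k mulnDl [((C1 + C2) * _)%N]mulnDl; apply: leq_add.
    by rewrite leq_mul2l leq_pexp2l ?orbT.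
  have bound l K m : (m <= n)%N ->
      (m * (l * (K * (2 * (2 * n) ^ d))) <= l * (K * (2 * 2 ^ d)) * n ^ d.+1)%N.
    move=> mn; rewrite expnMn expnS; apply: leq_trans (leq_mul mn (leqnn _)) _.
    by apply: eq_leq; ring.
  apply: leq_add; [apply: (bound e.+1 K1)|apply: (bound e'.+1 K2)];
    exact: size_side.
have mult_nform x v L f : p (nform x v L f) = nform (p x) (p v) L f.
  by rewrite /nform mult_prod; apply: eq_bigr => i _; rewrite mult_zexp fil_mult.
have := pu1; rewrite {1}uE !gmulfM (cost_kernel cc) mulg1 !mult_zexp !mult_nform.
move=> /uniqG [t0 s0 a0 b0 ab0].
have nformE x v l f : (forall i, (i < l)%N -> f i = 0%R) ->
    nform x v l.+1 f = zexp (fil x v l) (f l).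
  by move=> f0; rewrite /nform big_ord_recr /= big1 ?mul1g // => i _; rewrite f0.
have bE : b e' = (- a e)%R by apply/eqP; rewrite -addr_eq0 addrC ab0.
have {}uE : wval gens u = zexp amalg (a e) * c.
  rewrite uE t0 s0 !zexp0 !mul1g !nformE // VeE bE zexpN.
  have am : central amalg by exact: kernel_central.
  rewrite zexpMg; last exact/commute_sym.
  rewrite (commute_zexp (a e) (commute_sym (am (zexp (fil Y W e') (a e))))).
  by rewrite mulgK.
rewrite uE mulnDl addnC.
have [_ cm cM _ _] := costP; apply: cm (cM _ _ _ _ (cost_zexp costP _ K4P) cc) _.
apply: leq_add => //; rewrite -mulnA leq_mul2l; apply/orP; right.
by rewrite (_ : `|a e|%N = `|b e'|%N) // bE abszN.
Qed.
End CentralExtension.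

(** * Wreath products with function modules *)

(** Taken with T = int * int for a model of Gamma, and with T = int for the lower bounds. *)
Definition shift_group (T : zmodType) : Type := (T * (T -> int))%type.
HB.instance Definition _ (T : zmodType) := Choice.on (shift_group T).
Definition shift_elt (T : zmodType) (t : T) (f : T -> int) : shift_group T := (t, f).

Section ShiftGroup.
Local Open Scope ring_scope.
Variable T : zmodType.
Implicit Types u v w : shift_group T.

Definition shift_mul u v : shift_group T := (u.1 + v.1, fun x => u.2 (x + v.1) + v.2 x).
Definition shift_one : shift_group T := (0, fun=> 0).
Definition shift_inv u : shift_group T := (- u.1, fun x => - u.2 (x - u.1)).

Fact shift_mulA : associative shift_mul.
Proof.
move=> u v w; congr (_, _) => /=; first by rewrite addrA.
by apply/funext => x; rewrite addrA -(addrA x) (addrC w.1).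
Qed.
Fact shift_mul1 : left_id shift_one shift_mul.
Proof.
by case=> t f; congr (_, _) => /=; [rewrite add0r|apply/funext => x; rewrite add0r].
Qed.
Fact shift_mulr1 : right_id shift_one shift_mul.
Proof.
by case=> t f; congr (_, _) => /=; [rewrite addr0|apply/funext => x; rewrite !addr0].
Qed.
Fact shift_mulV : left_inverse shift_one shift_inv shift_mul.
Proof.
move=> u; congr (_, _) => /=; first by rewrite addNr.
by apply/funext => x; rewrite addrK addNr.
Qed.
Fact shift_mulrV : right_inverse shift_one shift_inv shift_mul.
Proof.
move=> u; congr (_, _) => /=; first by rewrite addrN.
by apply/funext => x; rewrite addrN.
Qed.
HB.instance Definition _ := isGroup.Build (shift_group T)
  shift_mulA shift_mul1 shift_mulr1 shift_mulV shift_mulrV.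

Lemma shift_mulE (t s : T) f g :
  (shift_elt t f * shift_elt s g)%g = shift_elt (t + s) (fun x => f (x + s) + g x).
Proof. by []. Qed.

Lemma shift_invE (t : T) f : (shift_elt t f)^-1%g = shift_elt (- t) (fun x => - f (x - t)).
Proof. by []. Qed.

Lemma shift_oneE : 1%g = shift_elt (0 : T) (fun=> 0).
Proof. by []. Qed.

Lemma shift_mul1_fst u v : (u * v)%g.1 = u.1 + v.1.
Proof. by []. Qed.

Lemma shift_zexp1 u n : (zexp u n).1 = u.1 *~ n.
Proof.
have H (k : nat) : (u ^+ k)%g.1 = u.1 *+ k.
  by elim: k => // k IH; rewrite expgS shift_mul1_fst IH mulrS.
by case: n => n /=; rewrite ?NegzE ?mulrNz; [rewrite H|congr (- _); exact: H].
Qed.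

Lemma shift_comm (u : shift_group T) (f : T -> int) :
  [~ u, shift_elt 0 f]%g = shift_elt 0 (fun x => f x - f (x + u.1)).
Proof.
case: u => t g; rewrite -/(shift_elt t g) /commg /conjg !shift_invE !shift_mulE.
congr shift_elt => /=.
  by rewrite oppr0 addr0 add0r addNr.
by apply/funext => x; rewrite ?(oppr0, addr0, add0r) addrK; ring.
Qed.

Lemma shift_conj (u : shift_group T) (f : T -> int) :
  (shift_elt 0 f ^ u)%g = shift_elt 0 (fun x => f (x + u.1)).
Proof.
case: u => t g; rewrite -/(shift_elt t g) /conjg shift_invE !shift_mulE; congr shift_elt.
  by rewrite add0r addNr.
by apply/funext => x; rewrite add0r addrK; ring.
Qed.

Lemma shift_mul0 (f g : T -> int) :
  (shift_elt 0 f * shift_elt 0 g)%g = shift_elt 0 (fun x => f x + g x).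
Proof.
by rewrite shift_mulE addr0; congr shift_elt; apply/funext => x; rewrite addr0.
Qed.

Lemma shift_inv0 (f : T -> int) : (shift_elt 0 f)^-1%g = shift_elt 0 (fun x => - f x).
Proof.
by rewrite shift_invE oppr0; congr shift_elt; apply/funext => x; rewrite addr0.
Qed.

Lemma shift_commute0 (f g : T -> int) : commute (shift_elt 0 f) (shift_elt 0 g).
Proof.
by rewrite /commute !shift_mul0; congr shift_elt; apply/funext => x; rewrite addrC.
Qed.

Lemma shift_zexp0 (f : T -> int) n :
  zexp (shift_elt 0 f) n = shift_elt 0 (fun x => n * f x).
Proof.
have H (k : nat) : (shift_elt 0 f ^+ k)%g = shift_elt 0 (fun x => k%:Z * f x).
  elim: k => [|k IH].
    by rewrite expg0 shift_oneE; congr shift_elt; apply/funext => x; rewrite mul0r.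
  rewrite expgS IH shift_mul0; congr shift_elt; apply/funext => x.
  by rewrite -addn1 PoszD mulrDl mul1r addrC.
case: n => n; rewrite /zexp H // shift_inv0; congr shift_elt; apply/funext => x.
by rewrite NegzE mulNr.
Qed.

Lemma shift_prod0 (F : nat -> T -> int) n :
  (\prod_(i < n) shift_elt 0 (F i))%g = shift_elt 0 (fun x => \sum_(i < n) F i x).
Proof.
elim: n => [|n IH].
  by rewrite big_ord0 shift_oneE; congr shift_elt; apply/funext => x; rewrite big_ord0.
rewrite big_ord_recr /= IH shift_mul0; congr shift_elt; apply/funext => x.
by rewrite big_ord_recr.
Qed.
End ShiftGroup.

Local Open Scope ring_scope.

(* (-1)^k binom(x, k), continued to negative x. *)
Definition gbin (k : nat) (x : int) : int :=
  match x with Posz n => (-1) ^+ k * 'C(n, k)%:Z | Negz n => 'C(n + k, k)%:Z end.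

Lemma gbin0 x : gbin 0 x = 1.
Proof. by case: x => n; rewrite /gbin bin0 ?mulr1. Qed.

(** The sign in [gbin] is chosen to fit the difference f(x) - f(x+1), which is what [x, -] induces
    on functions by [shift_comm]. *)
Lemma gbinS k x : gbin k.+1 x - gbin k.+1 (x + 1) = gbin k x.
Proof.
case: x => [n|[|n]].
- rewrite -PoszD addn1 /= binS PoszD exprS; ring.
- by rewrite NegzE addNr /= !add0n !binn bin0n mulr0 subr0.
have -> : Negz n.+1 + 1 = Negz n by rewrite !NegzE -[n.+2]addn1 PoszD; ring.
by rewrite /= addSn binS PoszD addnS addrC addKr addSn.
Qed.

Lemma gbin_small k n : (n < k)%N -> gbin k n = 0.
Proof. by move=> nk; rewrite /= bin_small ?mulr0. Qed.

Lemma gbin_diag k : gbin k k = (-1) ^+ k.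
Proof. by rewrite /= binn mulr1. Qed.

Lemma fil_gbin (T : zmodType) (u : shift_group T) (pr : T -> int) e i : (i <= e)%N ->
  (forall x, pr (x + u.1) = pr x + 1) ->
  fil u (shift_elt 0 (fun x => gbin e (pr x))) i = shift_elt 0 (fun x => gbin (e - i) (pr x)).
Proof.
move=> ie pr1; elim: i ie => [|i IH] ie; first by rewrite subn0.
rewrite /fil /= -/(fil _ _ i) IH ?(ltnW ie) // shift_comm; congr shift_elt.
by apply/funext => x; rewrite pr1 -(gbinS (e - i.+1)) subnSK.
Qed.

Lemma fil_gbin_end (T : zmodType) (u : shift_group T) (pr : T -> int) e :
  (forall x, pr (x + u.1) = pr x + 1) ->
  fil u (shift_elt 0 (fun x => gbin e (pr x))) e.+1 = 1%g.
Proof.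
move=> pr1; rewrite /fil /= -/(fil _ _ e) fil_gbin // shift_comm shift_oneE.
by congr shift_elt; apply/funext => x; rewrite subnn !gbin0 subrr.
Qed.

Lemma fil_gbin_rel (T : zmodType) (u : shift_group T) (pr : T -> int) e :
  (forall x, pr (x + u.1) = pr x + 1) ->
  filiform_rel e u (shift_elt 0 (fun x => gbin e (pr x))).
Proof.
move=> pr1; split; last exact: fil_gbin_end.
have H i : exists f, fil u (shift_elt 0 (fun x => gbin e (pr x))) i = shift_elt 0 f.
  have [ie|ie] := leqP i e; first by rewrite fil_gbin //; eexists.
  by rewrite (fil_eq1 (fil_gbin_end _ pr1) ie) shift_oneE; eexists.
by move=> i j; case: (H i) => f ->; case: (H j) => g ->; exact: shift_commute0.
Qed.

Arguments gbin : simpl never.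

(** The system is triangular: [gbin k n] is 0 for n < k and a sign for n = k. The value at 0 gives a
    e = c, and the values at m = 1, ..., e then give a (e - m) = 0 one after the other. *)
Lemma gbin_independent e (a : nat -> int) c :
  (forall n : nat, \sum_(i < e.+1) a i * gbin (e - i) n = c) ->
  forall i, (i < e)%N -> a i = 0.
Proof.
move=> H; have ae : a e = c.
  rewrite -(H 0%N) big_ord_recr /= subnn gbin0 mulr1 big1 ?add0r // => i _.
  by rewrite gbin_small ?mulr0 // subn_gt0.
have key m : (0 < m <= e)%N -> a (e - m)%N = 0.
  elim/ltn_ind: m => m IH /andP[m0 me].
  have := H m; rewrite big_ord_recr /= subnn gbin0 mulr1 ae => /eqP.
  rewrite -subr_eq0 addrK => /eqP.
  have em : (e - m < e)%N by lia.
  rewrite (bigD1 (Ordinal em)) //= subKn // big1.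
    rewrite addr0 gbin_diag => /eqP.
    by rewrite mulf_eq0 signr_eq0 orbF => /eqP.
  move=> i ne; have [lt|le] := ltnP m (e - i); first by rewrite gbin_small ?mulr0.
  have {}ne : (e - i != m)%N.
    apply: contra ne => /eqP im; apply/eqP/val_inj => /=; have := ltn_ord i.
    by rewrite -im; lia.
  have -> : val i = (e - (e - i))%N by have := ltn_ord i => /=; lia.
  by rewrite IH ?mul0r //; have := ltn_ord i; lia.
by move=> i ie; rewrite -(subKn (ltnW ie)); apply: key; lia.
Qed.

(** * A model of the central product by functions of two variables *)

Section CentralProductModel.
Variables e e' : nat.
Local Notation T := (int * int)%type.

(** Each of x and y translates one coordinate, and v and w are binomials in that coordinate. Both
    chains of differences end in the constant function 1, which realises the amalgamation. *)
Definition model_x : shift_group T := shift_elt (1, 0) (fun=> 0).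
Definition model_v : shift_group T := shift_elt 0 (fun x => gbin e x.1).
Definition model_y : shift_group T := shift_elt (0, 1) (fun=> 0).
Definition model_w : shift_group T := shift_elt 0 (fun x => gbin e' x.2).

Let fst1 (x : T) : (x + model_x.1).1 = x.1 + 1. Proof. by []. Qed.
Let snd1 (x : T) : (x + model_y.1).2 = x.2 + 1. Proof. by []. Qed.

Lemma model_central_product : central_product_rel e e' model_x model_v model_y model_w.
Proof.
split.
- exact: (fil_gbin_rel (pr := fst)).
- exact: (fil_gbin_rel (pr := snd)).
- split; last first.
    apply/commgP/eqP; rewrite /model_w shift_comm shift_oneE; congr shift_elt.
    by apply/funext => x; rewrite /= addr0 subrr.
  by rewrite /commute /model_x /model_y !shift_mulE; congr shift_elt.
- split; last exact: shift_commute0.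
  apply/commgP/eqP; rewrite -invgR /model_v shift_comm shift_inv0 shift_oneE; congr shift_elt.
  by apply/funext => x; rewrite /= addr0 subrr oppr0.
rewrite (fil_gbin (pr := fst)) // (fil_gbin (pr := snd)) //; congr shift_elt.
by apply/funext => x; rewrite !subnn !gbin0.
Qed.

Lemma model_nform (u v : shift_group T) (F : nat -> T -> int) n a :
  (forall i, (i < n)%N -> fil u v i = shift_elt 0 (F i)) ->
  nform u v n a = shift_elt 0 (fun x => \sum_(i < n) a i * F i x).
Proof.
move=> H; rewrite /nform -(shift_prod0 (fun i x => a i * F i x)).
by apply: eq_bigr => i _; rewrite H // shift_zexp0.
Qed.

(** The translation part gives t = s = 0. An identity f(x) + g(y) = 0 makes f and g constant, so
    [gbin_independent] applies to each, and their constants are opposite. *)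
Lemma model_unique : normal_form_unique e e' model_x model_v model_y model_w.
Proof.
move=> t a s b.
rewrite (model_nform (F := fun i x => gbin (e - i) x.1)); last first.
  by move=> i ie; rewrite (fil_gbin (pr := fst)).
rewrite (model_nform (F := fun i x => gbin (e' - i) x.2)); last first.
  by move=> i ie; rewrite (fil_gbin (pr := snd)).
set f := fun _ => _; set g := fun _ => _ => H.
have /(congr1 fst) := H; rewrite !shift_mul1_fst !shift_zexp1 /=.
have pairz (p q : int) n : ((p, q) : T) *~ n = (p *~ n, q *~ n).
  have Hn (k : nat) : ((p, q) : T) *+ k = (p *+ k, q *+ k).
    by elim: k => // k IH; rewrite !mulrS IH.
  by case: n => n; rewrite ?NegzE ?mulrNz /intmul Hn.
rewrite !pairz; case.
rewrite !mul0rz !addr0 !add0r => t0 s0.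
have {}t0 : t = 0 by rewrite -t0 intz.
have {}s0 : s = 0 by rewrite -s0 intz.
subst t s; move: H; rewrite !zexp0 !mul1g shift_mul0 => /(congr1 snd) /= fg.
have fg0 x y : f (x, y) + g (x, y) = 0 by rewrite -[LHS]/((fun z => f z + g z) (x, y)) fg.
have sum0 k (c : nat -> int) : \sum_(i < k.+1) c i * gbin (k - i) 0 = c k.
  rewrite big_ord_recr /= subnn gbin0 mulr1 big1 ?add0r // => i _.
  by rewrite gbin_small ?mulr0 // subn_gt0.
have f0 (n : nat) : \sum_(i < e.+1) a i * gbin (e - i) n = a e.
  rewrite -(sum0 e a); apply: (addIr (g (0%R, 0%R))).
  exact: etrans (fg0 n 0%R) (esym (fg0 0%R 0%R)).
have g0 (n : nat) : \sum_(i < e'.+1) b i * gbin (e' - i) n = b e'.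
  rewrite -(sum0 e' b); apply: (addrI (f (0%R, 0%R))).
  exact: etrans (fg0 0%R n) (esym (fg0 0%R 0%R)).
split=> //; [exact: gbin_independent f0|exact: gbin_independent g0|].
by rewrite -(sum0 e a) -(sum0 e' b); exact: fg0.
Qed.
End CentralProductModel.

Lemma normal_form_unique_lift (G H : groupType) (f : {multiplicative G -> H}) e e' x v y w :
  normal_form_unique e e' (f x) (f v) (f y) (f w) -> normal_form_unique e e' x v y w.
Proof.
have fE u z L a : f (nform u z L a) = nform (f u) (f z) L a.
  by rewrite /nform mult_prod; apply: eq_bigr => i _; rewrite mult_zexp fil_mult.
move=> uniq t a s b /(congr1 f); rewrite mult1 !gmulfM !mult_zexp !fE; exact: uniq.
Qed.

Lemma Gamma_unique e e' :
  normal_form_unique e e' (Gamma_x e e') (Gamma_v e e') (Gamma_y e e') (Gamma_w e e').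
Proof.
have [f [fx fv fy fw]] := Gamma_universal (model_central_product e e').
by apply: (normal_form_unique_lift (f := f)); rewrite fx fv fy fw; exact: model_unique.
Qed.

Local Close Scope ring_scope.

(** * Centralised Dehn functions: upper bound *)

Lemma wval_inv (S : choiceType) (H : groupType) (f : S -> H) w :
  wval f (inv_word w) = (wval f w)^-1.
Proof.
elim: w => [|a w IH]; first by rewrite /inv_word wval_nil invg1.
rewrite /inv_word /= rev_cons -cats1 wval_cat -/(inv_word w) IH !wval_cons wval_nil mulg1.
by rewrite invgM /lval; case: a => s [] /=; rewrite ?invgK.
Qed.

Lemma size_inv_word (S : choiceType) (w : seq (S * bool)) : size (inv_word w) = size w.
Proof. by rewrite /inv_word size_rev size_map. Qed.

Lemma least_le (P : nat -> Prop) k : P k -> (least P <= k)%N.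
Proof.
move=> Pk; rewrite /least; case: pselect => // exP.
by case: ex_minnP => m _; apply; apply/asboolP.
Qed.

Lemma leastP (P : nat -> Prop) k : P k -> P (least P).
Proof.
move=> Pk; rewrite /least; case: pselect => [exP|[]]; last by exists k; apply/asboolP.
by case: ex_minnP => m /asboolP.
Qed.

Lemma comm_subgroup_sub (G : groupType) (H K : set G) x y :
  H x -> K y -> comm_subgroup H K [~ x, y].
Proof. by move=> Hx Ky; apply: gen_subgroup_sub; exists x, y. Qed.

Section CentralisedArea.
Variables (S : finType) (R : seq (free_group S)).
Local Notation F := (free_group S).
Local Notation N := (comm_subgroup [set: F] (relators R)).
Local Notation Q := (quot N).
Local Notation pi := (quot_pi N).

Let nR : is_normal (relators R) := normal_closure_normal [set` R].

Lemma cent_quotP (u w : F) : pi u = pi w <-> N (u^-1 * w).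
Proof. by rewrite quot_piP (normal_closure_id (normal_comm_subgroup nR)). Qed.

(** At most k relators rather than exactly k, so that the predicate is monotone in k as [is_cost]
    requires. *)
Definition cent_cost (a : Q) (k : nat) : Prop := exists2 s : seq F,
  (forall r, r \in s -> sym_relator R r) /\ (size s <= k)%N & a = pi (\prod_(r <- s) r).

Lemma sym_relatorV r : sym_relator R r -> sym_relator R r^-1.
Proof. by case=> h; [right; rewrite invgK|left]. Qed.

Lemma sym_relator_relators r : sym_relator R r -> relators R r.
Proof.
case=> h; first exact: normal_closure_sub.
by rewrite -[r]invgK; apply: (normalV nR); exact: normal_closure_sub.
Qed.

Lemma relators_central w : relators R w -> central (pi w).
Proof.
move=> Rw x; rewrite -(quot_reprK x); apply/esym; rewrite -!gmulfM; apply/cent_quotP.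
rewrite invgM -!mulgA -[X in N X]/[~ w, quot_repr x] -invgR.
apply: (subgroupV (gen_subgroup_subgroup _)); apply: comm_subgroup_sub Rw => //.
Qed.

Lemma cent_costP : is_cost cent_cost.
Proof.
split.
- by exists [::]; rewrite ?big_nil ?mult1.
- by move=> a k l [s [sR sk] ->] kl; exists s => //; split=> //; exact: leq_trans kl.
- move=> a b k l [s [sR sk] ->] [t [tR tl] ->]; exists (s ++ t).
    split; last by rewrite size_cat leq_add.
    by move=> r; rewrite mem_cat => /orP[/sR|/tR].
  by rewrite big_cat gmulfM.
- move=> a k [s [sR sk] ->]; exists (rev (map (fun r : F => r^-1) s)).
    split; last by rewrite size_rev size_map.
    by move=> r; rewrite mem_rev => /mapP[t /sR tR ->]; exact: sym_relatorV.
  rewrite -multV; congr pi; elim: s {sR sk} => [|r s IH]; first by rewrite !big_nil invg1.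
  by rewrite /= rev_cons big_rcons /= big_cons invgM IH.
- move=> a k x [s [sR _] ->]; apply: relators_central.
  rewrite big_seq; elim/big_ind: _ => [|u v|r /sR]; first exact: normal1.
    exact: normalM.
  exact: sym_relator_relators.
Qed.

Lemma cent_cost_relators w : relators R w -> exists k, cent_cost (pi w) k.
Proof.
have [c1 cm cM cV cC] := cent_costP.
have nK : is_normal [set w | exists k, cent_cost (pi w) k].
  split; first apply: is_subgroup_intro => [|u v [k hk] [l hl]|u [k hk]] /=.
  - by exists 0%N; rewrite mult1.
  - by exists (k + l)%N; rewrite gmulfM; exact: cM.
  - by exists k; rewrite multV; exact: cV.
  move=> u v [k hk]; exists k; rewrite multJ.
  by have /commgP/conjg_fixP -> := cC _ _ (pi v) hk.
apply: (normal_closure_ind nK) => r /= rR; exists 1%N.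
exists [:: r]; last by rewrite big_seq1.
by split=> // t; rewrite inE => /eqP ->; left.
Qed.

Lemma has_cent_area_cost w k : cent_cost (pi w) k ->
  exists2 l, (l <= k)%N & has_cent_area R w l.
Proof.
case=> s [sR sk] /cent_quotP h; exists (size s) => //.
exists (fun i => tnth (in_tuple s) i); split=> [i|]; first by apply: sR; exact: mem_tnth.
by rewrite -(big_tnth _ _ s xpredT id).
Qed.

Lemma cent_area_le w k : cent_cost (pi w) k -> (cent_area R w <= k)%N.
Proof. by case/has_cent_area_cost => l lk /least_le h; exact: leq_trans lk. Qed.

Lemma has_cent_area_min w : relators R w -> has_cent_area R w (cent_area R w).
Proof. by case/cent_cost_relators => k /has_cent_area_cost [l _]; exact: leastP. Qed.
End CentralisedArea.

Lemma gens_words (Q : groupType) (X V Y W : Q) :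
  (forall H : set Q, is_subgroup H -> H X -> H V -> H Y -> H W -> forall g, H g) ->
  forall g, exists u, wval (gens X V Y W) u = g.
Proof.
move=> gen; apply: gen.
- apply: is_subgroup_intro => [|_ _ [u <-] [w <-]|_ [u <-]] /=.
  + by exists [::]; rewrite wval_nil.
  + by exists (u ++ w); rewrite wval_cat.
  + by exists (inv_word u); rewrite wval_inv.
- by exists [:: (false, false, false)]; rewrite wval_cons wval_nil mulg1.
- by exists [:: (false, true, false)]; rewrite wval_cons wval_nil mulg1.
- by exists [:: (true, false, false)]; rewrite wval_cons wval_nil mulg1.
- by exists [:: (true, true, false)]; rewrite wval_cons wval_nil mulg1.
Qed.

Section UpperBound.
Variables (S : finType) (R : seq (free_group S)) (e e' d : nat).
Hypothesis presR : presents R (Gamma e.+2 e'.+2).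
Hypotheses (e0 : (0 < e)%N) (e'0 : (0 < e')%N) (d0 : (0 < d)%N) (e'd : (e' <= d)%N).
Hypothesis ed : (e <= d + odd e)%N.
Local Notation F := (free_group S).
Local Notation N := (comm_subgroup [set: F] (relators R)).
Local Notation pi := (quot_pi N).
Local Notation Ga := (Gamma e.+2 e'.+2).

(** In Q each generator s of the given presentation equals a fixed word in the lifts X, V, Y, W
    times a central element of fixed cost. A word of length n thus becomes one of length at most L *
    n with a central error of cost at most K * n. *)
Lemma cent_dehn_upper : exists C, forall n, (cent_dehn R n <= C * n ^ d.+1)%N.
Proof.
have [psi [psi_surj psi_ker]] := presR.
have nR : is_normal (relators R) := normal_closure_normal [set` R].
have psiN a : N a -> psi a = 1.
  move=> Na; apply/psi_ker; move: a Na; apply: gen_subgroup_ind; first by case: nR.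
  move=> _ [x [y [_ Ry ->]]]; rewrite -invgR; apply: (normalV nR).
  by apply: (normalM nR); [exact: (normalV nR)|exact: (normalJ nR)].
have [p pE] := quot_lift psiN.
have costP := cent_costP R.
have kerp a : p a = 1 -> exists k, cent_cost (R := R) a k.
  by rewrite -(quot_reprK a) pE => /psi_ker; exact: cent_cost_relators.
have costk a k : cent_cost (R := R) a k -> p a = 1.
  case=> s [sR _ ->]; rewrite pE mult_prod big_seq big1 // => r /sR rR.
  by apply/psi_ker; exact: sym_relator_relators.
have lift g : exists a, p a = g.
  by have [w <-] := psi_surj g; exists (pi w).
have [X pX] := lift (Gamma_x e e'); have [V pV] := lift (Gamma_v e e').
have [Y pY] := lift (Gamma_y e e'); have [W pW] := lift (Gamma_w e e').
have rel : central_product_rel e e' (p X) (p V) (p Y) (p W).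
  by rewrite pX pV pY pW; exact: Gamma_central_product.
have uniq : normal_form_unique e e' (p X) (p V) (p Y) (p W).
  by rewrite pX pV pY pW; exact: Gamma_unique.
have [C CP] := central_word_cost costP kerp costk e0 e'0 d0 e'd ed rel uniq.
have letters s : exists ua : seq (bool * bool * bool) * nat,
    nearby (cent_cost (R := R)) ua.2 (pi (free_gen s)) (wval (gens X V Y W) ua.1).
  have gen := @gens_words Ga _ _ _ _ (@Gamma_generated e e').
  have [u uE] := gen (psi (free_gen s)).
  have : p ((wval (gens X V Y W) u)^-1 * pi (free_gen s)) = 1.
    rewrite gmulfM multV pE -uE gmulf_wval (_ : wval _ u = wval (gens (p X) (p V) (p Y) (p W)) u).
      by rewrite pX pV pY pW mulVg.
    by rewrite /wval; apply: eq_bigr => -[[[] []] b] _.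
  by case/kerp => k ck; exists (u, k); exists ((wval (gens X V Y W) u)^-1 * pi (free_gen s));
    rewrite ?mulVKg.
have [ua uaP] := choice letters.
pose L := (\sum_s size (ua s).1)%N; pose K := (\sum_s (ua s).2)%N.
pose sub (a : S * bool) := if a.2 then inv_word (ua a.1).1 else (ua a.1).1.
have words (w : seq (S * bool)) : exists2 u, (size u <= L * size w)%N &
    nearby (cent_cost (R := R)) (K * size w) (pi (free_of_word w)) (wval (gens X V Y W) u).
  elim: w => [|a w [u uL near_u]].
    by exists [::]; rewrite // free_of_wordE !wval_nil mult1; exact: nearby_refl.
  exists (sub a ++ u).
    rewrite size_cat mulnS leq_add // /sub.
    have : (size (ua a.1).1 <= L)%N by rewrite /L (bigD1 a.1) //= leq_addr.
    by case: ifP => _; rewrite ?size_inv_word.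
  rewrite free_of_word_cons gmulfM wval_cat mulnS; apply: nearbyM => //.
  apply: (@nearby_mono _ _ costP (ua a.1).2); last by rewrite /K (bigD1 a.1) //= leq_addr.
  rewrite /lval /sub; case: ifP => _; last exact: uaP.
  by rewrite multV wval_inv; apply: nearbyV.
exists (K + C * L ^ d.+1)%N => n; apply/bigmax_leqP => w /asboolP Rw.
have [u uL [c cc wE]] := words w.
have pu : p (wval (gens X V Y W) u) = 1.
  by move: (congr1 p wE); rewrite gmulfM (costk _ _ cc) mulg1 pE => <-; apply/psi_ker.
have wn : (size w <= n)%N := size_bseq w.
have [_ cm cM _ _] := costP.
apply: cent_area_le; rewrite wE; apply: cm (cM _ _ _ _ (CP u pu) cc) _.
rewrite addnC mulnDl leq_add //.
  rewrite leq_mul2l (leq_trans wn) ?orbT // expnS.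
  by have [->|n0] := posnP n; rewrite // leq_pmulr // expn_gt0 n0.
rewrite -mulnA leq_mul2l -expnMn leq_exp2r //.
by rewrite (leq_trans uL) ?orbT // leq_mul2l wn orbT.
Qed.
End UpperBound.

(** * Lower bounds from group extensions *)

(** Conjugation invariance takes the place of centrality: [has_area] allows conjugates of relators,
    and the bounded functions that estimate [dehn] are not central. *)
Definition is_norm (E : groupType) (L : E -> nat -> Prop) : Prop :=
  [/\ L 1 0%N,
      forall x k l, L x k -> (k <= l)%N -> L x l,
      forall x y k l, L x k -> L y l -> L (x * y) (k + l)%N,
      forall x k, L x k -> L x^-1 k &
      forall x y k, L x k -> L (x ^ y) k].

Lemma is_cost_norm (E : groupType) (L : E -> nat -> Prop) : is_cost L -> is_norm L.
Proof.
case=> L1 Lm LM LV LC; split=> // x y k Lx.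
by have /commgP/conjg_fixP -> := LC _ _ y Lx.
Qed.

Lemma is_norm_normal (E : groupType) (L : E -> nat -> Prop) :
  is_norm L -> is_normal [set x | exists k, L x k].
Proof.
case=> L1 Lm LM LV LJ; split; last by move=> x y [k Lk]; exists k; exact: LJ.
apply: is_subgroup_intro => [|x y [k hk] [l hl]|x [k hk]].
- by exists 0%N.
- by exists (k + l)%N; exact: LM.
- by exists k; exact: LV.
Qed.

Section Areas.
Variables (S : finType) (R : seq (free_group S)).
Local Notation F := (free_group S).

Lemma has_area_relators w : relators R w -> exists k, has_area R w k.
Proof.
pose A (s : seq (F * F)) := (forall a, a \in s -> sym_relator R a.1).
pose K := [set w : F | exists2 s, A s & w = \prod_(a <- s) (a.1 ^ a.2)].
have nK : is_normal K.
  split; first apply: is_subgroup_intro => [|_ _ [s sA ->] [t tA ->]|_ [s sA ->]].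
  - by exists [::]; rewrite ?big_nil.
  - exists (s ++ t); last by rewrite big_cat.
    by move=> a; rewrite mem_cat => /orP[/sA|/tA].
  - exists (rev [seq (a.1^-1, a.2) | a <- s]).
      by move=> a; rewrite mem_rev => /mapP[b /sA bA ->]; exact: sym_relatorV.
    elim: s {sA} => [|a s IH]; first by rewrite !big_nil invg1.
    by rewrite /= rev_cons big_rcons /= big_cons invgM IH conjVg.
  move=> _ u [s sA ->]; exists [seq (a.1, a.2 * u) | a <- s].
    by move=> a /mapP[b /sA bA ->].
  by rewrite big_map conjg_prod; apply: eq_bigr => a _; rewrite conjgM.
suff RK : [set` R] `<=` K.
  move=> /(normal_closure_ind nK RK) [s sA ->]; exists (size s).
  exists (fun i => (tnth (in_tuple s) i).2), (fun i => (tnth (in_tuple s) i).1).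
  split=> [i|]; first by apply: sA; exact: mem_tnth.
  by rewrite -(big_tnth _ _ s xpredT (fun a => a.1 ^ a.2)).
move=> r rR; exists [:: (r, 1)]; last by rewrite big_seq1 conjg1.
by move=> a; rewrite inE => /eqP ->; left.
Qed.

Variables (E : groupType) (L : E -> nat -> Prop) (rho : {multiplicative F -> E}) (K : nat).
Hypothesis rhoR : forall r, r \in R -> L (rho r) K.

Lemma norm_prod k (f : 'I_k -> E) : is_norm L -> (forall i, L (f i) K) ->
  L (\prod_(i < k) f i) (K * k)%N.
Proof.
case=> L1 Lm LM LV LJ; elim: k f => [|k IH] f fL.
  by rewrite big_ord0 muln0.
by rewrite big_ord_recl mulnS; apply: LM => //; exact: IH.
Qed.

Lemma norm_sym_relator r : is_norm L -> sym_relator R r -> L (rho r) K.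
Proof.
case=> L1 Lm LM LV LJ [/rhoR //|/rhoR].
by move=> /LV; rewrite multV invgK.
Qed.

Lemma area_lower w : is_norm L -> relators R w -> L (rho w) (K * area R w)%N.
Proof.
move=> normL /has_area_relators [k /leastP [u [r [rR wE]]]].
rewrite [in L _]wE mult_prod; apply: norm_prod => // i; rewrite multJ.
by have [_ _ _ _ LJ] := normL; apply: LJ; exact: norm_sym_relator.
Qed.

(** Since [rho] sends relators to central elements, it kills [F, relators]; an equality modulo that
    subgroup can therefore be evaluated in E. *)
Lemma cent_area_lower w : is_cost L -> relators R w -> L (rho w) (K * cent_area R w)%N.
Proof.
move=> costL Rw; have normL := is_cost_norm costL.
have [r [rR]] := has_cent_area_min Rw.
have nR := normal_closure_normal [set` R].
have rel_central u : relators R u -> central (rho u).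
  have nN := is_norm_normal normL.
  have := normal_closure_ind (preimage_normal rho nN) (A := [set` R]).
  move=> h /h [|k Lk x]; first by move=> a /rhoR; exists K.
  by case: costL => _ _ _ _ c; exact: c Lk.
have N1 u : comm_subgroup [set: F] (relators R) u -> rho u = 1.
  apply: (gen_subgroup_ind (H := rho @^-1` [set 1])).
    by case: (preimage_normal rho (is_normal1 E)).
  move=> _ [x [y [_ Ry ->]]] /=; rewrite multR; apply/eqP/commgP/commute_sym.
  exact: rel_central.
move=> /N1; rewrite gmulfM multV => /mulg1_eq; rewrite invgK => ->.
by rewrite mult_prod; apply: norm_prod => // i; exact: norm_sym_relator.
Qed.
End Areas.

Section DehnSize.
Variables (S : finType) (R : seq (free_group S)).
Local Notation F := (free_group S).

Lemma area_le_dehn (w : F) n : relators R w -> (size (free_word w) <= n)%N ->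
  (area R w <= dehn R n)%N.
Proof.
move=> Rw wn; rewrite -{1}[w]free_wordK.
pose b : n.-bseq (S * bool) := Bseq wn.
apply: (leq_bigmax_cond (F := fun b : n.-bseq (S * bool) => area R (free_of_word b)) b).
by apply/asboolP; rewrite free_wordK.
Qed.

Lemma cent_area_le_dehn (w : F) n : relators R w -> (size (free_word w) <= n)%N ->
  (cent_area R w <= cent_dehn R n)%N.
Proof.
move=> Rw wn; rewrite -{1}[w]free_wordK.
pose b : n.-bseq (S * bool) := Bseq wn.
apply: (leq_bigmax_cond (F := fun b : n.-bseq (S * bool) => cent_area R (free_of_word b)) b).
by apply/asboolP; rewrite free_wordK.
Qed.

Definition wlen (w : F) : nat := size (free_word w).

Lemma size_reduce (w : seq (S * bool)) : (size (reduce w) <= size w)%N.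
Proof.
elim: w => //= a w IH; rewrite /reduce /= -/(reduce w).
by case: (reduce w) IH => [|b v] //= vw; case: ifP => _ //=; apply: leq_trans (ltnW vw) _.
Qed.

Lemma wlenM u v : (wlen (u * v)%g <= wlen u + wlen v)%N.
Proof. by apply: leq_trans (size_reduce _) _; rewrite size_cat. Qed.

Lemma wlenV u : (wlen u^-1%g <= wlen u)%N.
Proof. by apply: leq_trans (size_reduce _) _; rewrite size_inv_word. Qed.

Lemma wlenX u n : (wlen (u ^+ n)%g <= n * wlen u)%N.
Proof.
elim: n => // n IH; rewrite expgS mulSn.
by apply: leq_trans (wlenM _ _) _; rewrite leq_add2l.
Qed.

Lemma wlenR u v : (wlen [~ u, v]%g <= 2 * (wlen u + wlen v))%N.
Proof.
rewrite /commg /conjg; apply: leq_trans (wlenM _ _) _.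
apply: leq_trans (leq_add (wlenV u) (leq_trans (wlenM _ _) _)) _.
  exact: leq_add (wlenV v) (wlenM u v).
by lia.
Qed.

Lemma wlen_fil u v i n : (wlen (fil (u ^+ n) (v ^+ n) i)%g <= 4 ^ i * (wlen u + wlen v) * n)%N.
Proof.
elim: i => [|i IH].
  by apply: leq_trans (wlenX _ _) _; rewrite expn0 mul1n mulnC leq_mul2r leq_addl orbT.
rewrite /fil /= -/(fil _ _ i); apply: leq_trans (wlenR _ _) _.
have := wlenX u n; rewrite expnS.
set a := wlen (u ^+ n); set b := wlen (fil _ _ _) in IH *; set A := (4 ^ i)%N in IH *.
have A0 : (0 < A)%N by rewrite expn_gt0.
have : (wlen u * n <= A * (wlen u + wlen v) * n)%N.
  by rewrite leq_mul2r; apply/orP; right; rewrite (leq_trans (leq_addr (wlen v) _)) // leq_pmull.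
move: IH; set B := (A * _ * n)%N.
have -> : (4 * A * (wlen u + wlen v) * n = 4 * B)%N by rewrite /B !mulnA.
by rewrite [(n * _)%N]mulnC; lia.
Qed.
End DehnSize.

(** * Iterated commutators of powers in a filiform group *)

Section IteratedCommutators.
Variables (G : groupType) (e : nat) (x v : G).
Hypothesis relV : filiform_rel e x v.

(** The subgroup generated by x_(i+2), ..., x_p. It locates iterated commutators of powers without
    computing exponents, which is enough to see that the test words are null-homotopic. *)
Definition lower_term (i : nat) : set G :=
  gen_subgroup [set g | exists2 j, (i <= j)%N & g = fil x v j].

Let sub i := gen_subgroup_subgroup [set g | exists2 j, (i <= j)%N & g = fil x v j].

Lemma lower_term_commute i j g h : lower_term i g -> lower_term j h -> commute g h.
Proof.
move=> Hg Hh.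
have S2 : lower_term j `<=` [set h | commute g h].
  apply: gen_subgroup_ind => [|_ [k _ ->]] /=.
    apply: is_subgroup_intro; [exact: commute1|exact: commuteM|exact: commuteV].
  move: g Hg; apply: gen_subgroup_ind => [|_ [l _ ->]] /=; first exact: subgroup_centraliser.
  by case: relV.
exact: S2.
Qed.

Lemma lower_term_end g : lower_term e.+1 g -> g = 1.
Proof.
move: g; apply: gen_subgroup_ind; first by case: (is_normal1 G).
by move=> _ [j ej ->]; rewrite /= (fil_eq1 _ ej) //; case: relV.
Qed.

Lemma lower_term_conj i g : lower_term i g -> lower_term i (g ^ x).
Proof.
move: g; apply: gen_subgroup_ind => [|_ [j ij ->]] /=.
  apply: is_subgroup_intro => [|a b|a] /=; rewrite ?conj1g ?conjMg ?conjVg.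
  - exact: (subgroup1 (sub i)).
  - exact: (subgroupM (sub i)).
  - exact: (subgroupV (sub i)).
rewrite fil_conj; apply: (subgroupM (sub i)).
  by apply: gen_subgroup_sub; exists j.
apply: (subgroupV (sub i)); apply: gen_subgroup_sub; exists j.+1 => //; exact: leqW.
Qed.

(** On the abelian subgroup [lower_term i] the map g -> [x, g] is a homomorphism, so it is enough to
    look at generators. *)
Lemma lower_term_comm i g : lower_term i g -> lower_term i.+1 [~ x, g].
Proof.
suff H : lower_term i `<=` [set g | lower_term i g /\ lower_term i.+1 [~ x, g]].
  by move=> /H [].
have s1 := sub i; have s2 := sub i.+1.
apply: gen_subgroup_ind => [|_ [j ij ->]] /=; last first.
  by split; apply: gen_subgroup_sub; [exists j|exists j.+1].
apply: is_subgroup_intro => [|a b [ha ca] [hb cb]|a [ha ca]] /=.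
- by rewrite commg1; split; [exact: (subgroup1 s1)|exact: (subgroup1 s2)].
- split; first exact: (subgroupM s1).
  have -> : [~ x, a * b] = [~ x, b] * [~ x, a]; last exact: (subgroupM s2).
  have cb' : commute [~ x, a] b by apply: lower_term_commute ca hb.
  by rewrite (commgEr x b) (commgEr x (a * b)) invgM conjMg -!mulgA -cb' (commgEr x a) !mulgA.
split; first exact: (subgroupV s1).
have -> : [~ x, a^-1] = [~ x, a]^-1; last exact: (subgroupV s2).
rewrite !commgEr invgK conjVg invgM invgK.
exact: (commuteV (lower_term_commute (lower_term_conj ha) ha)).
Qed.

Lemma lower_term_commX i n g : lower_term i g -> lower_term i.+1 [~ x ^+ n, g].
Proof.
move=> hg; suff [] : lower_term i (g ^ (x ^+ n)) /\ lower_term i.+1 [~ x ^+ n, g] by [].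
have s2 := sub i.+1; elim: n => [|n [IH1 IH2]].
  by rewrite expg0 conjg1 comm1g; split=> //; exact: (subgroup1 s2).
rewrite expgSr conjgM; split; first exact: lower_term_conj.
have -> : [~ x ^+ n * x, g] = [~ x, g ^ (x ^+ n)] * [~ x ^+ n, g].
  by rewrite !commgEr conjgM !conjVg mulgA mulgK.
by apply: (subgroupM s2) => //; exact: lower_term_comm.
Qed.

Lemma lower_term_fil n m i : lower_term i (fil (x ^+ n) (v ^+ m) i).
Proof.
elim: i => [|i IH]; last exact: lower_term_commX.
change (lower_term 0 (v ^+ m)); elim: m => [|m IH]; first exact: (subgroup1 (sub 0)).
rewrite expgS; apply: (subgroupM (sub 0)) => //.
by apply: gen_subgroup_sub; exists 0%N.
Qed.
End IteratedCommutators.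

(** With the second factor sent to 1, the amalgamated centre dies too: what remains is a quotient of
    Lambda_p by its element x_p. *)
Lemma killed_central_product (H : groupType) e e' (x v : H) :
  (forall i j, commute (fil x v i) (fil x v j)) -> fil x v e = 1 ->
  central_product_rel e e' x v 1 1.
Proof.
move=> Vc Ve; have fil1 i : fil (1 : H) 1 i = 1 by apply: (fil_eq1 (e := 0)).
split.
- by split=> //; apply: fil_eq1 Ve _.
- by split=> [i j|]; rewrite !fil1 //; exact: commute1.
- by split; exact: commute1.
- by split; exact: commute1.
- by rewrite Ve fil1.
Qed.

(** * Transfer of norms from an extension of a quotient of Gamma *)

Section ExtensionLift.
Variables (E : groupType) (L : E -> nat -> Prop) (x0 v0 : E) (e e' : nat).
Hypothesis normL : is_norm L.
Hypothesis comm0 : forall i j, exists k, L [~ fil x0 v0 i, fil x0 v0 j] k.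
Hypothesis end0 : exists k, L (fil x0 v0 e) k.
Variables (S : finType) (R : seq (free_group S)).
Hypothesis presR : presents R (Gamma e.+2 e'.+2).
Local Notation F := (free_group S).

(** Let M be the subgroup of elements of finite norm. Modulo M the pair x0, v0 satisfies the
    relations of Gamma, and lifting the images of the generators from E / M to E defines [rho] on
    the free group. Relators land in M, with a common bound since R is finite. The lifts are
    controlled only modulo M, whence the finite errors on [rho xw] and [rho vw]. *)
Lemma extension_lift : exists (psi : {multiplicative F -> Gamma e.+2 e'.+2})
    (rho : {multiplicative F -> E}) (K : nat) (xw vw : F),
  [/\ forall w, psi w = 1 <-> relators R w,
      psi xw = Gamma_x e e' /\ psi vw = Gamma_v e e',
      exists k, L (x0^-1 * rho xw) k, exists k, L (v0^-1 * rho vw) k &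
      forall r, r \in R -> L (rho r) K].
Proof.
pose M := [set x : E | exists k, L x k].
have nM : is_normal M := is_norm_normal normL.
have pi1 x : quot_pi M x = 1 <-> M x by rewrite quot_pi1P normal_closure_id.
have rel : central_product_rel e e' (quot_pi M x0) (quot_pi M v0) 1 1.
  apply: killed_central_product => [i j|]; rewrite -!fil_mult; last exact/pi1.
  by apply/commgP/eqP; rewrite -multR; apply/pi1; exact: comm0.
have [alpha [ax av _ _]] := Gamma_universal rel.
have [psi [psi_surj psi_ker]] := presR.
have [rho rhoE] := free_lift (fun s => quot_repr (alpha (psi (free_gen s)))).
have rho_pi w : quot_pi M (rho w) = alpha (psi w).
  rewrite -[w]free_wordK free_of_wordE !gmulf_wval /wval.
  apply: eq_bigr => -[s b] _; rewrite /lval /= rhoE.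
  by case: b; rewrite quot_reprK.
have [xw xwE] := psi_surj (Gamma_x e e'); have [vw vwE] := psi_surj (Gamma_v e e').
have rhoR r : r \in R -> exists k, L (rho r) k.
  move=> rR; apply/pi1; rewrite rho_pi (_ : psi r = 1) ?mult1 //.
  by apply/psi_ker; apply: normal_closure_sub.
have [K KP] : exists K, forall r, r \in R -> L (rho r) K.
  have [_ Lm _ _ _] := normL; elim: (R) rhoR => [|r s IH] h; first by exists 0%N.
  have [K KP] : exists K, forall r, r \in s -> L (rho r) K.
    by apply: IH => t ts; apply: h; rewrite inE ts orbT.
  have [k kP] := h r (mem_head r s); exists (maxn K k) => t; rewrite inE => /orP[/eqP ->|ts].
    by apply: Lm kP _; exact: leq_maxr.
  by apply: Lm (KP t ts) _; exact: leq_maxl.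
exists psi, rho, K, xw, vw; split=> //.
- have /quot_piP : quot_pi M x0 = quot_pi M (rho xw) by rewrite rho_pi xwE ax.
  by rewrite normal_closure_id.
- have /quot_piP : quot_pi M v0 = quot_pi M (rho vw) by rewrite rho_pi vwE av.
  by rewrite normal_closure_id.
Qed.
End ExtensionLift.

(** * Iterated differences *)

Local Open Scope ring_scope.

Definition fdiff (n : int) (f : int -> int) (x : int) : int := f x - f (x + n).

Section Differences.
Implicit Types f g : int -> int.

Lemma iter_diffD n e f g x :
  iter e (fdiff n) (fun x => f x + g x) x = iter e (fdiff n) f x + iter e (fdiff n) g x.
Proof. by elim: e x => //= e IH x; rewrite /fdiff !IH; ring. Qed.

Lemma iter_diffZ n e c f x :
  iter e (fdiff n) (fun x => c * f x) x = c * iter e (fdiff n) f x.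
Proof. by elim: e x => //= e IH x; rewrite /fdiff !IH; ring. Qed.

Lemma iter_diff_shift n e f y x :
  iter e (fdiff n) (fun x => f (x + y)) x = iter e (fdiff n) f (x + y).
Proof. by elim: e x => //= e IH x; rewrite /fdiff !IH addrAC. Qed.

Lemma iter_diff_sum n e (F : nat -> int -> int) k x :
  iter e (fdiff n) (fun x => \sum_(j < k) F j x) x = \sum_(j < k) iter e (fdiff n) (F j) x.
Proof.
elim: e x => //= e IH x; rewrite /fdiff !IH -sumrB; exact: eq_bigr.
Qed.

Lemma diff_nat (n : nat) f x : fdiff n%:Z f x = \sum_(j < n) fdiff 1 f (x + j%:Z).
Proof.
elim: n => [|n IH]; first by rewrite big_ord0 /fdiff addr0 subrr.
rewrite big_ord_recr /= -IH /fdiff -addn1 PoszD !addrA; ring.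
Qed.

(** A difference of step n is a sum of n translated unit differences, so each of the e differences
    contributes a factor n. Only the half-line to the right of x is involved, which allows truncated
    binomials. *)
Lemma iter_diff_nat (n e : nat) f c x :
  (forall y, x <= y -> iter e (fdiff 1) f y = c) -> iter e (fdiff n%:Z) f x = n%:Z ^+ e * c.
Proof.
elim: e f c => [|e IH] f c H; first by rewrite mul1r; exact: H.
rewrite iterSr (IH _ (n%:Z * c)); first by rewrite exprSr mulrA.
move=> y xy.
have -> : fdiff n%:Z f = (fun x => \sum_(j < n) fdiff 1 f (x + j%:Z)).
  by apply/funext => z; exact: diff_nat.
rewrite (iter_diff_sum 1 e (fun j x => fdiff 1 f (x + j%:Z))) (eq_bigr (fun=> c)).
  by rewrite sumr_const card_ord -mulr_natl natz.
by move=> j _; rewrite iter_diff_shift -iterSr H // (le_trans xy) // lerDl.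
Qed.

Lemma iter_diff_bound n e f (B : int) : (forall x, `|f x| <= B) ->
  forall x, `|iter e (fdiff n) f x| <= 2 ^+ e * B.
Proof.
move=> fB; elim: e => [|e IH] x; first by rewrite mul1r.
rewrite /= /fdiff exprS; apply: le_trans (ler_normB _ _) _.
by apply: le_trans (lerD (IH x) (IH (x + n))) _; rewrite -mulrA mulr_natl mulr2n.
Qed.

Lemma iter_diff0 (n e : nat) f x : (forall y, y <= x + (e * n)%N%:Z -> f y = 0) ->
  iter e (fdiff n%:Z) f x = 0.
Proof.
elim: e x => [|e IH] x H; first by apply: H; rewrite mul0n addr0.
rewrite /= /fdiff !IH ?subr0 // => y yx; apply: H; move: yx; rewrite mulSn PoszD; lia.
Qed.
End Differences.

Lemma fil_shift (u v : shift_group int) (f : int -> int) i :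
  v = shift_elt 0 f -> fil u v i = shift_elt 0 (iter i (fdiff u.1) f).
Proof.
move=> ->; elim: i => //= i IH; rewrite -/(fil _ _ i) IH shift_comm; congr shift_elt.
Qed.

(** * Lower bound for the Dehn function *)

(* The successive differences are again truncated, down to 1_(x >= 0), which is
   bounded (so trivial modulo bounded functions) but not shift-invariant. *)
Definition tbin (k : nat) (x : int) : int := if x is Posz _ then gbin k x else 0.

Lemma tbinS k x : fdiff 1 (tbin k.+1) x = tbin k x.
Proof.
rewrite /fdiff; case: x => [n|[|n]]; first by have := gbinS k n; rewrite -PoszD addn1.
  by rewrite NegzE addNr /= gbin_small // subrr.
by have -> : Negz n.+1 + 1 = Negz n by rewrite !NegzE -[n.+2]addn1 PoszD; ring.
Qed.

Lemma iter_tbin e i : (i <= e)%N -> iter i (fdiff 1) (tbin e) = tbin (e - i).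
Proof.
elim: i => [|i IH] ie; first by rewrite subn0.
by rewrite /= IH ?(ltnW ie) //; apply/funext => x; rewrite -(subnSK ie) tbinS.
Qed.

Lemma tbin0 x : tbin 0 x = if x is Posz _ then 1 else 0.
Proof. by case: x => n //=; rewrite gbin0. Qed.

Definition sup_norm (u : shift_group int) (k : nat) : Prop :=
  u.1 = 0 /\ forall x, `|u.2 x| <= k%:Z.

Lemma sup_norm_elt (u : shift_group int) k : sup_norm u k -> u = shift_elt 0 u.2.
Proof. by case: u => t f [/= -> _]. Qed.

Lemma sup_normP : is_norm sup_norm.
Proof.
split.
- by split=> // x; rewrite normr0.
- by move=> u k l [u1 uk] kl; split=> // x; apply: le_trans (uk x) _; rewrite lez_nat.
- move=> u v k l Hu Hv; have [_ uk] := Hu; have [_ vl] := Hv.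
  rewrite (sup_norm_elt Hu) (sup_norm_elt Hv) shift_mul0; split=> // x /=.
  by apply: le_trans (ler_normD _ _) _; rewrite PoszD lerD.
- move=> u k Hu; have [_ uk] := Hu.
  by rewrite (sup_norm_elt Hu) shift_inv0; split=> // x /=; rewrite normrN.
move=> u v k Hu; have [_ uk] := Hu; rewrite (sup_norm_elt Hu).
by rewrite shift_conj; split=> // x /=.
Qed.

Section DehnLower.
Variables (S : finType) (R : seq (free_group S)) (e e' : nat).
Hypothesis presR : presents R (Gamma e.+2 e'.+2).
Hypothesis e0 : (0 < e)%N.

Lemma dehn_lower : exists A, forall n m, (A * n + A <= m)%N ->
  (n ^ e.+1 <= A * dehn R m + A)%N.
Proof.
pose x0 : shift_group int := shift_elt 1 (fun=> 0).
pose v0 : shift_group int := shift_elt 0 (tbin e).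
have filE i : fil x0 v0 i = shift_elt 0 (iter i (fdiff 1) (tbin e)) by exact: fil_shift.
have [i j||psi [rho [K [xw [vw [psi_ker [psix psiv] [k1 k1P] [k2 k2P] KP]]]]]] :=
    extension_lift (x0 := x0) (v0 := v0) sup_normP _ _ presR.
- exists 0%N; rewrite !filE.
  have /commgP/eqP -> := shift_commute0 (iter i (fdiff 1) (tbin e)) (iter j (fdiff 1) (tbin e)).
  by case: sup_normP.
- exists 1%N; rewrite filE iter_tbin // subnn; split=> // x /=.
  by rewrite tbin0; case: x.
(* Commutators with functions see only the translation part of [rho xw], so its bounded error is
   harmless. *)
have X1 n : (rho xw ^+ n)%g.1 = n%:Z.
  have x1 : (rho xw).1 = 1.
    by have [/= + _] := k1P; rewrite addrC => /subr0_eq.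
  by elim: n => [|n IH]; rewrite ?expg0 // expgS shift_mul1_fst x1 IH -PoszD add1n.
have [mu muB VE] : exists2 mu : int -> int, (forall x, `|mu x| <= k2%:Z) &
    rho vw = shift_elt 0 (fun x => tbin e x + mu x).
  exists (v0^-1 * rho vw)%g.2; first by case: k2P => _; exact.
  by rewrite -[rho vw in LHS](mulVKg v0) (sup_norm_elt k2P) shift_mul0.
(* [C * n] bounds two values of n times the e-th difference of the error [mu]: such a difference is
   at most 2 ^ e * k2. *)
pose C := (2 * 2 ^ e * k2)%N.
have key n : exists2 w, relators R w & 
    (wlen w <= 2 * ((e * n + 1) * wlen xw + 4 ^ e * (wlen xw + wlen vw) * n))%N /\
    (n ^ e.+1 <= K * area R w + C * n)%N.
  pose m := (e * n + 1)%N; pose Om := fil (xw ^+ n)%g (vw ^+ n)%g e.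
  have Rw : relators R [~ xw ^+ m, Om]%g.
    apply/psi_ker; rewrite /Om multR multX fil_mult !multX psix psiv.
    have rel : filiform_rel e (Gamma_x e e') (Gamma_v e e').
      by case: (Gamma_central_product e e').
    apply: (lower_term_end rel); apply: (lower_term_commX rel); exact: lower_term_fil rel _ _ _.
  (* m is so large that shifting by m moves the support of Om's function off 0. *)
  exists [~ xw ^+ m, Om]%g => //; split.
    apply: leq_trans (wlenR _ _) _; rewrite leq_mul2l /= leq_add ?wlenX ?wlen_fil //.
  (* Let f be the function of [rho Om]. At -m the commutator takes the value f(-m) - f(0), where, up
     to the error from [mu], f(0) = n^(e+1) and f(-m) = 0. *)
  have [_] := area_lower KP sup_normP Rw => /(_ (- m%:Z)).
  rewrite /Om multR multX fil_mult !multX.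
  rewrite (@fil_shift _ _ (fun x => n%:Z * (tbin e x + mu x))); last first.
    by rewrite VE -[X in X = _]/(zexp _ n%:Z) shift_zexp0.
  rewrite !X1 shift_comm X1 /= !iter_diffZ !iter_diffD addNr.
  set T0 := iter e (fdiff n) (tbin e) 0; set T1 := iter e (fdiff n) (tbin e) _.
  have -> : T0 = n%:Z ^+ e.
    rewrite /T0 (@iter_diff_nat n e (tbin e) 1) ?mulr1 // => y; rewrite iter_tbin // subnn tbin0.
    by case: y.
  have -> : T1 = 0.
    by apply: iter_diff0 => y; rewrite /m; case: y => // y; lia.
  have := iter_diff_bound n e muB (- m%:Z); have := iter_diff_bound n e muB 0.
  set U0 := iter e _ mu 0; set U1 := iter e _ mu _; set X := (K * _)%N.
  rewrite !ler_norml => /andP[U0l _] /andP[_ U1r] /andP[D _].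
  have n0 : 0 <= n%:Z by [].
  have h0 := ler_wpM2l n0 U0l; have h1 := ler_wpM2l n0 U1r.
  rewrite -lez_nat PoszD expnS /C !PoszM (_ : (n ^ e)%N%:Z = n%:Z ^+ e); last first.
    by elim: (e) => // i IH; rewrite expnS PoszM IH exprS.
  rewrite (_ : (2 ^ e)%N%:Z = 2 ^+ e); last first.
    by elim: (e) => // i IH; rewrite expnS PoszM IH exprS.
  rewrite (_ : 2%:Z * _ * k2 * n = 2%:Z * (n%:Z * (2 ^+ e * k2%:Z))); last by ring.
  set B := 2 ^+ e * _ in h0 h1 *; set N := n%:Z ^+ e in D *.
  have -> : n%:Z * N = n%:Z * U1 - n%:Z * U0 - (n%:Z * (0 + U1) - n%:Z * (N + U0)) by ring.
  by move: D h0 h1; rewrite mulrN; set p := _ - _ in |- *; lia.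
pose A := (2 * K + C ^ 2 + 2 * ((e + 1) * wlen xw + 4 ^ e * (wlen xw + wlen vw)) + 2 * wlen xw)%N.
exists A => n m Anm; have [w Rw [wn key_w]] := key n.
have : (area R w <= dehn R m)%N.
  apply: area_le_dehn => //; apply: leq_trans wn _; apply: leq_trans Anm.
  rewrite /A; set b := wlen xw; set c := (4 ^ e * _)%N; nia.
set a := area R w in key_w *; move: (dehn R m) => D aD.
(* This absorbs the linear error: 2 * C * n <= n^2 + C^2, and n^2 <= n^(e+1) because e > 0. *)
have n2 : (n * n <= n ^ e.+1)%N.
  have [->//|n0] := posnP n; rewrite -[(n * n)%N]/(n ^ 2)%N leq_pexp2l //.
have : (2 * (C * n) <= n * n + C ^ 2)%N by have := (nat_Cauchy C n).1; rewrite -mulnn addnC.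
have : (K * a <= K * D)%N by rewrite leq_mul2l aD orbT.
move=> aKD Cn; apply: (@leq_trans (2 * (K * D) + C ^ 2)); first by lia.
rewrite mulnA leq_add //; first by rewrite leq_mul2r; apply/orP; right; rewrite /A; lia.
by rewrite /A; lia.
Qed.
End DehnLower.

(** * Lower bound for the centralised Dehn function *)

(** A triple (t, (f, c)) stands for a translation, a function and a central coordinate; the index d
    ties the type to the Heisenberg-like group law built on [shift_form d]. *)
Definition heis (d : nat) : Type := (int * ((int -> int) * (int -> int)))%type.
HB.instance Definition _ (d : nat) := Choice.on (heis d).
Definition heis_elt (d : nat) (t : int) (f c : int -> int) : heis d := (t, (f, c)).

Section ShiftForm.
Variable d : nat.
Implicit Types f g h : int -> int.

(* Summation by parts makes this a constant function when f and g are
   polynomial of degree at most d, whence a shift-invariant bilinear form. *)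
Definition shift_form f g (x : int) : int :=
  \sum_(i < d.+1) iter i (fdiff 1) f x * iter (d - i) (fdiff (-1)) g x.
Local Notation W := shift_form.

Lemma shift_form_ext f f' g g' x : f =1 f' -> g =1 g' -> W f g x = W f' g' x.
Proof. by move=> /funext -> /funext ->. Qed.

Lemma shift_formDl f g h x : W (fun y => f y + g y) h x = W f h x + W g h x.
Proof.
by rewrite /W -big_split; apply: eq_bigr => i _; rewrite iter_diffD mulrDl.
Qed.

Lemma shift_formDr f g h x : W f (fun y => g y + h y) x = W f g x + W f h x.
Proof.
by rewrite /W -big_split; apply: eq_bigr => i _; rewrite iter_diffD mulrDr.
Qed.

Lemma shift_formZl c f g x : W (fun y => c * f y) g x = c * W f g x.
Proof.
by rewrite /W mulr_sumr; apply: eq_bigr => i _; rewrite iter_diffZ mulrA.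
Qed.

Lemma shift_formZr c f g x : W f (fun y => c * g y) x = c * W f g x.
Proof.
by rewrite /W mulr_sumr; apply: eq_bigr => i _; rewrite iter_diffZ; ring.
Qed.

Lemma shift_form_shift f g s x : W (fun y => f (y + s)) (fun y => g (y + s)) x = W f g (x + s).
Proof. by apply: eq_bigr => i _; rewrite !iter_diff_shift. Qed.

Lemma shift_formNl f g x : W (fun y => - f y) g x = - W f g x.
Proof.
by rewrite -mulN1r -shift_formZl; congr (W _ _ _); apply/funext => y; rewrite mulN1r.
Qed.

Lemma shift_formNr f g x : W f (fun y => - g y) x = - W f g x.
Proof.
by rewrite -mulN1r -shift_formZr; congr (W _ _ _); apply/funext => y; rewrite mulN1r.
Qed.

Lemma shift_form0l g x : W (fun=> 0) g x = 0.
Proof.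
have -> : (fun=> 0) = (fun y : int => 0 * (fun=> 0 : int) y).
  by apply/funext => y; rewrite mul0r.
by rewrite shift_formZl mul0r.
Qed.

Lemma shift_form0r f x : W f (fun=> 0) x = 0.
Proof.
have -> : (fun=> 0) = (fun y : int => 0 * (fun=> 0 : int) y).
  by apply/funext => y; rewrite mul0r.
by rewrite shift_formZr mul0r.
Qed.

Lemma backward_diff k f x :
  iter k (fdiff (-1)) f x = (-1) ^+ k * iter k (fdiff 1) f (x - k%:Z).
Proof.
elim: k x => [|k IH] x; first by rewrite mul1r subr0.
rewrite /= /fdiff !IH exprS.
have -> : x - k.+1%:Z + 1 = x - k%:Z by rewrite -addn1 PoszD; ring.
have -> : x + -1 - k%:Z = x - k.+1%:Z by rewrite -addn1 PoszD; ring.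
ring.
Qed.

Definition poly_fun f : Prop := forall x, iter d.+1 (fdiff 1) f x = 0.

(** The difference of the two values telescopes, and each of the two end terms contains a (d+1)-st
    difference of f or of g. *)
Lemma shift_form_step f g x : poly_fun f -> poly_fun g -> W f g x = W f g (x + 1).
Proof.
move=> pf pg; apply/eqP; rewrite -subr_eq0 -sumrB; apply/eqP.
pose t i := iter i (fdiff 1) f x * iter (d.+1 - i) (fdiff (-1)) g (x + 1).
rewrite (eq_bigr (fun i : 'I_d.+1 => t i.+1 - t i)).
  rewrite -(big_mkord xpredT (fun i => t i.+1 - t i)) telescope_sumr // /t subnn subn0.
  by rewrite pf mul0r sub0r backward_diff pg !mulr0 oppr0.
move=> [i id] _; rewrite /t /= subSS subSn //= /fdiff addrK; ring.
Qed.

Lemma shift_form_const f g x : poly_fun f -> poly_fun g -> W f g x = W f g 0.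
Proof.
move=> pf pg; elim/int_rec: x => // n <-.
  by rewrite -addn1 PoszD -shift_form_step.
by rewrite (shift_form_step _ pf pg); congr (W _ _ _); rewrite -addn1 PoszD; ring.
Qed.

Lemma poly_fun_diff f : poly_fun f -> poly_fun (fdiff 1 f).
Proof. by move=> pf x; rewrite -iterSr iterS /fdiff !pf subrr. Qed.

Lemma poly_fun_shift f : poly_fun f -> poly_fun (fun x => f (x + 1)).
Proof. by move=> pf x; rewrite iter_diff_shift pf. Qed.

Lemma poly_fun_iter f i : poly_fun f -> poly_fun (iter i (fdiff 1) f).
Proof. by move=> pf; elim: i => // i; exact: poly_fun_diff. Qed.

Lemma iter_gbin i : (i <= d)%N -> iter i (fdiff 1) (gbin d) = gbin (d - i).
Proof.
elim: i => [|i IH] id; first by rewrite subn0.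
by rewrite /= IH ?(ltnW id) //; apply/funext => x; rewrite -(subnSK id) /fdiff gbinS.
Qed.

Lemma poly_fun_gbin : poly_fun (gbin d).
Proof. by move=> x; rewrite iterS iter_gbin // subnn /fdiff !gbin0 subrr. Qed.

Lemma iter_fdiff_cst n i c : iter i.+1 (fdiff n) (fun=> c) = fun=> 0.
Proof.
elim: i => [|i IH]; first by apply/funext => x; rewrite /= /fdiff subrr.
by rewrite iterS IH; apply/funext => x; rewrite /fdiff subrr.
Qed.

Lemma shift_form_gbin1 x : W (gbin d) (fun=> 1) x = 1.
Proof.
rewrite /W big_ord_recr /= iter_gbin // subnn gbin0 mulr1 big1 ?add0r // => -[i id] _ /=.
by rewrite -(subnSK id) iter_fdiff_cst mulr0.
Qed.

Lemma shift_form_1gbin x : W (fun=> 1) (gbin d) x = (-1) ^+ d.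
Proof.
rewrite /W big_ord_recl big1 => [|i _].
  by rewrite addr0 /= subn0 backward_diff iter_gbin // subnn gbin0 mulr1 mul1r.
by rewrite (iter_fdiff_cst 1 i 1) mul0r.
Qed.

Local Notation heis := (heis d).
Local Notation heis_elt := (@heis_elt d).

(* The third coordinate is a function, rather than an integer, because
   shift_form is not constant outside the polynomials of degree at most d. *)
Definition heis_mul (u v : heis) : heis :=
  heis_elt (u.1 + v.1) (fun x => u.2.1 (x + v.1) + v.2.1 x)
    (fun x => u.2.2 (x + v.1) + v.2.2 x + W (fun y => u.2.1 (y + v.1)) v.2.1 x).
Definition heis_one : heis := heis_elt 0 (fun=> 0) (fun=> 0).
Definition heis_inv (u : heis) : heis :=
  heis_elt (- u.1) (fun x => - u.2.1 (x - u.1))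
    (fun x => - u.2.2 (x - u.1) + W u.2.1 u.2.1 (x - u.1)).

Fact heis_mulA : associative heis_mul.
Proof.
move=> [t [f c]] [s [g b]] [r [h a]]; congr heis_elt => /=; first by rewrite addrA.
  by apply/funext => x; rewrite addrA -(addrA x) (addrC r).
apply/funext => x; rewrite shift_formDr shift_formDl -(addrA x) (addrC r).
rewrite -(shift_form_shift _ _ r).
have -> : (fun y => f (y + r + s)) = (fun y => f (y + (s + r))).
  by apply/funext => y; rewrite -addrA (addrC r).
ring.
Qed.
Fact heis_mul1 : left_id heis_one heis_mul.
Proof.
case=> t [f c]; congr heis_elt; rewrite /= ?add0r //; apply/funext => x; rewrite add0r //.
by rewrite shift_form0l addr0.
Qed.
Fact heis_mulr1 : right_id heis_one heis_mul.
Proof.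
case=> t [f c]; congr heis_elt; rewrite /= ?addr0 //; apply/funext => x; rewrite !addr0 //.
by rewrite shift_form0r addr0.
Qed.
Fact heis_mulV : left_inverse heis_one heis_inv heis_mul.
Proof.
case=> t [f c]; congr heis_elt; rewrite /= ?addNr //; apply/funext => x; rewrite addrK.
  by rewrite addNr.
have -> : (fun y => - f (y + t - t)) = (fun y => - f y).
  by apply/funext => y; rewrite addrK.
by rewrite shift_formNl; ring.
Qed.
Fact heis_mulrV : right_inverse heis_one heis_inv heis_mul.
Proof.
case=> t [f c]; congr heis_elt; rewrite /= ?addrN //; apply/funext => x; rewrite ?addrN //.
by rewrite shift_formNr (shift_form_shift f f (- t)); ring.
Qed.
HB.instance Definition _ := isGroup.Build heis
  heis_mulA heis_mul1 heis_mulr1 heis_mulV heis_mulrV.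

Lemma heis_mulE t s f g c b : (heis_elt t f c * heis_elt s g b)%g =
  heis_elt (t + s) (fun x => f (x + s) + g x)
    (fun x => c (x + s) + b x + W (fun y => f (y + s)) g x).
Proof. by []. Qed.

(** For elements with t = 0 the commutator ignores the third coordinate, so the powers and brackets
    that enter it can be computed in [shift_group int]. *)
Definition heis_proj (u : heis) : shift_group int := shift_elt u.1 u.2.1.
Fact heis_proj_morph : {morph heis_proj : u v / (u * v)%g}.
Proof. by []. Qed.
HB.instance Definition _ :=
  isMultiplicative.Build heis (shift_group int) heis_proj heis_proj_morph.

Lemma heis_eq (u : heis) t f : heis_proj u = shift_elt t f -> exists c, u = heis_elt t f c.
Proof. by case: u => s [g c] [-> ->]; exists c. Qed.

Lemma heis_comm f g c b :
  [~ heis_elt 0 f c, heis_elt 0 g b]%g = heis_elt 0 (fun=> 0) (fun x => W f g x - W g f x).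
Proof.
apply: (mulgI (heis_elt 0 g b * heis_elt 0 f c)%g); rewrite -commgC !heis_mulE !addr0.
congr heis_elt; apply/funext => x; first by rewrite !addr0 addrC.
rewrite shift_form0r !addr0 (@shift_form_ext _ f _ g) // => [|y]; last by rewrite addr0.
rewrite (@shift_form_ext (fun y => g (y + 0)) g _ f) // => [|y]; last by rewrite addr0.
ring.
Qed.

Lemma heis_comm1 f c : [~ heis_elt 1 (fun=> 0) (fun=> 0), heis_elt 0 f (fun=> c)]%g =
  heis_elt 0 (fdiff 1 f)
    (fun x => W (fun y => f (y + 1)) (fun y => f (y + 1)) x - W (fun y => f (y + 1)) f x).
Proof.
set u := heis_elt 1 _ _; set v := heis_elt 0 _ _.
apply: (mulgI (v * u)%g); rewrite -commgC !heis_mulE !addr0 add0r.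
pose f1 y := f (y + 1).
congr heis_elt; apply/funext => x; first by rewrite /fdiff !addr0 add0r; ring.
rewrite shift_form0l shift_form0r.
rewrite [W _ (fdiff 1 f) x](_ : _ = W f1 f x - W f1 f1 x).
  rewrite -/f1; ring.
rewrite (@shift_form_ext _ f1 _ (fun y => f y + - f1 y)) // => [|y]; last by rewrite /= !addr0.
by rewrite shift_formDr shift_formNr; ring.
Qed.

Definition heis_central (c : int) : heis := heis_elt 0 (fun=> 0) (fun=> c).

Definition heis_norm (u : heis) (k : nat) : Prop :=
  exists2 c : int, `|c| <= k%:Z & u = heis_central c.

Lemma heis_centralM b c : (heis_central b * heis_central c)%g = heis_central (b + c).
Proof.
rewrite /heis_central heis_mulE !addr0; congr heis_elt; apply/funext => x.
by rewrite shift_form0l addr0.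
Qed.

Lemma heis_centralP c : central (heis_central c).
Proof.
move=> [t [f b]]; rewrite /commute -/(heis_elt t f b) !heis_mulE; congr heis_elt.
- by rewrite addrC.
- by apply/funext => x; rewrite !addr0 add0r.
by apply/funext => x; rewrite !addr0 shift_form0l shift_form0r; ring.
Qed.

Lemma heis_normP : is_cost heis_norm.
Proof.
split.
- by exists 0.
- by move=> u k l [c ck ->] kl; exists c => //; apply: le_trans ck _; rewrite lez_nat.
- move=> u v k l [b bk ->] [c cl ->]; exists (b + c); last exact: heis_centralM.
  by apply: le_trans (ler_normD _ _) _; rewrite PoszD lerD.
- move=> u k [c ck ->]; exists (- c); first by rewrite normrN.
  by apply: mulg1_eq; rewrite heis_centralM subrr.
- by move=> u k x [c _ ->]; exact: heis_centralP.
Qed.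

(** All functions that occur are polynomials of degree at most d. On these the form is constant, so
    the third coordinate stays a constant function. *)
Lemma heis_fil i : exists c : int,
  fil (heis_elt 1 (fun=> 0) (fun=> 0)) (heis_elt 0 (gbin d) (fun=> 0)) i =
  heis_elt 0 (iter i (fdiff 1) (gbin d)) (fun=> c).
Proof.
elim: i => [|i [c IH]]; first by exists 0.
rewrite /fil /= -/(fil _ _ i) IH heis_comm1.
set f := iter i _ _; have pf : poly_fun f by exact/poly_fun_iter/poly_fun_gbin.
have pf1 := poly_fun_shift pf.
eexists.
congr heis_elt; apply/funext => x.
by rewrite shift_form_const // [X in _ - X]shift_form_const.
Qed.
End ShiftForm.

Section CentDehnLower.
Variables (S : finType) (R : seq (free_group S)) (e e' d : nat).
Hypothesis presR : presents R (Gamma e.+2 e'.+2).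
Hypotheses (oddd : odd d) (de : (d < e)%N).

(** In [heis d] the inner bracket [Om] carries the constant function n^(d+1) and v^n carries n *
    [gbin d]; bilinearity of the form then yields n^(d+2) up to a factor. *)
Lemma cent_dehn_lower : exists A, forall n m, (A * n + A <= m)%N ->
  (n ^ d.+2 <= A * cent_dehn R m + A)%N.
Proof.
pose x0 := heis_elt d 1 (fun=> 0) (fun=> 0); pose v0 := heis_elt d 0 (gbin d) (fun=> 0).
have costL := heis_normP d.
have [i j||psi [rho [K [xw [vw [psi_ker [psix psiv] [k1 [c1 _ xE]] [k2 [c2 _ vE]] KP]]]]]] :=
    extension_lift (x0 := x0) (v0 := v0) (is_cost_norm costL) _ _ presR.
- have [c ->] := heis_fil d i; have [b ->] := heis_fil d j; rewrite heis_comm.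
  have pf k : poly_fun d (iter k (fdiff 1) (gbin d)) by apply: poly_fun_iter; exact: poly_fun_gbin.
  set f := iter i _ _; set g := iter j _ _.
  exists `|shift_form d f g 0 - shift_form d g f 0|%N.
  exists (shift_form d f g 0 - shift_form d g f 0); first by rewrite abszE.
  congr heis_elt; apply/funext => x.
  by rewrite (shift_form_const x (pf i) (pf j)) (shift_form_const x (pf j) (pf i)).
(* As d < e, the e-th difference of [gbin d] is 0, so V_e reduces to a central integer. *)
- have [c ->] := heis_fil d e; exists `|c|%N; exists c; first by rewrite abszE.
  congr heis_elt; rewrite -(subnK de) iterD.
  rewrite (_ : iter d.+1 _ _ = (fun=> 0)); last by apply/funext => x; exact: poly_fun_gbin.
  by case: (e - d.+1)%N => // i; exact: iter_fdiff_cst.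
have projX (u : heis d) (n : nat) : heis_proj (u ^+ n)%g = (heis_proj u ^+ n)%g.
  exact: (multX (@heis_proj d)).
have {xE}xE : rho xw = (x0 * heis_central d c1)%g by rewrite -xE mulVKg.
have {vE}vE : rho vw = (v0 * heis_central d c2)%g by rewrite -vE mulVKg.
have projx : heis_proj (rho xw) = shift_elt 1 (fun=> 0).
  by rewrite xE; congr shift_elt.
have projv : heis_proj (rho vw) = shift_elt 0 (gbin d).
  by rewrite vE; congr shift_elt; apply/funext => x; rewrite /= !addr0.
have key n : exists2 w, relators R w &
    (wlen w <= 2 * (n * wlen vw + 4 ^ d * (wlen xw + wlen vw) * n))%N /\
    (n ^ d.+2 <= K * cent_area R w)%N.
  pose Om := fil (xw ^+ n)%g (vw ^+ n)%g d.
  have Rw : relators R [~ vw ^+ n, Om]%g.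
    apply/psi_ker; rewrite /Om multR multX fil_mult !multX psix psiv.
    have rel : filiform_rel e (Gamma_x e e') (Gamma_v e e').
      by case: (Gamma_central_product e e').
    apply/eqP/commgP; apply: (lower_term_commute rel (i := 0) (j := d)).
      exact: (@lower_term_fil _ _ _ _ rel n n 0).
    exact: lower_term_fil rel _ _ _.
  exists [~ vw ^+ n, Om]%g => //; split.
    by apply: leq_trans (wlenR _ _) _; rewrite leq_mul2l /= leq_add ?wlenX ?wlen_fil.
  have := cent_area_lower KP costL Rw; rewrite /Om multR multX fil_mult !multX.
  have Vn : heis_proj (rho vw ^+ n)%g = shift_elt 0 (fun x => n%:Z * gbin d x).
    rewrite projX projv -[LHS]/(zexp _ n%:Z); exact: shift_zexp0.
  have Xn : (heis_proj (rho xw ^+ n)%g).1 = n%:Z.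
    rewrite projX projx -[(_ ^+ n)%g]/(zexp _ n%:Z) shift_zexp1.
    by rewrite /= intz.
  have On : heis_proj (fil (rho xw ^+ n)%g (rho vw ^+ n)%g d) =
      shift_elt 0 (fun=> n%:Z ^+ d.+1 * 1).
    rewrite [LHS](fil_mult (@heis_proj d)) (fil_shift _ _ Vn) Xn; congr shift_elt.
    apply/funext => x; rewrite iter_diffZ (@iter_diff_nat n d (gbin d) 1) ?mulr1 -?exprS //.
    by move=> y _; rewrite iter_gbin // subnn gbin0.
  have [b ->] := heis_eq On; have [a ->] := heis_eq Vn; rewrite heis_comm.
  case=> c cK /(congr1 (fun u : heis d => u.2.2 0)) /=.
  rewrite shift_formZl shift_formZr shift_formZl shift_formZr shift_form_gbin1.
  rewrite shift_form_1gbin -signr_odd oddd /= => cE.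
  rewrite -lez_nat; apply: le_trans cK; rewrite -cE.
  have nE k : (n ^ k)%N%:Z = n%:Z ^+ k.
    by elim: k => // k IH; rewrite expnS PoszM IH exprS.
  rewrite nE; apply: le_trans (ler_norm _).
  (* For odd d the form takes the values 1 and -1 on the two orders of the pair, so the two terms of
     the commutator add up instead of cancelling. *)
  rewrite (_ : _ - _ = 2%:Z * n%:Z ^+ d.+2); last by rewrite !exprS; ring.
  by rewrite ler_peMl // exprn_ge0.
pose A := (K + 2 * (wlen vw + 4 ^ d * (wlen xw + wlen vw)))%N.
exists A => n m Anm; have [w Rw [wn key_w]] := key n.
have : (cent_area R w <= cent_dehn R m)%N.
  apply: cent_area_le_dehn => //; apply: leq_trans wn _; apply: leq_trans Anm.
  by rewrite /A; set b := wlen vw; set c := (4 ^ d * _)%N; nia.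
move=> aD; apply: leq_trans key_w _; rewrite /A.
apply: leq_trans (_ : K * cent_dehn R m <= _)%N; first by rewrite leq_mul2l aD orbT.
by rewrite mulnDl -addnA leq_addr.
Qed.
End CentDehnLower.

(** * Growth *)

Section Asymptotics.
Variable R : realType.
Implicit Types f g : nat -> nat.

Lemma preceq_nat f g A : (forall n, f n <= A * g (A * n + A) + A)%N ->
  preceq (fun n => (f n)%:R : R) (fun n => (g n)%:R).
Proof.
move=> fg; exists A => n; rewrite !ger0_norm ?ler0n // -natrM -natrD ler_nat.
exact: fg.
Qed.

(** Quantifying over all m beyond A * n + A lets the constant A be enlarged without any monotonicity
    of g. *)
Definition eventual_lower f g : Prop :=
  exists A, forall n m, (A * n + A <= m)%N -> (f n <= A * g m + A)%N.

Lemma preceq_lower f g : eventual_lower f g ->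
  preceq (fun n => (f n)%:R : R) (fun n => (g n)%:R).
Proof. by case=> A H; apply: (preceq_nat (A := A)) => n; exact: H. Qed.

Lemma preceq_lower_upper f g c C : (forall n, f n <= C * g n)%N -> eventual_lower g c ->
  preceq (fun n => (f n)%:R : R) (fun n => (c n)%:R).
Proof.
move=> fg [A H]; apply: (preceq_nat (A := (C.+1 * A.+1)%N)) => n.
apply: leq_trans (fg n) _.
have := H n (C.+1 * A.+1 * n + C.+1 * A.+1)%N.
rewrite (_ : (A * n + A <= _)%N); last first.
  by apply: leq_add; rewrite ?leq_mul2r; [apply/orP; right|]; nia.
move=> /(_ isT); set X := c _; set Y := g n => h.
apply: leq_trans (_ : C * (A * X + A) <= _)%N; first by rewrite leq_mul2l h orbT.
by rewrite mulnDr mulnA leq_add ?leq_mul2r //; [apply/orP; right|]; nia.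
Qed.

Lemma growth_exponent_le f m C : (forall n, f n <= C * n ^ m)%N ->
  (growth_exponent (fun n => (f n)%:R : R) <= m%:R%:E)%E.
Proof.
move=> fm; apply: ereal_inf_lbound; exists m%:R => //; split=> //.
exists C.+1 => n; rewrite powR_mulrn // !ger0_norm ?ler0n ?exprn_ge0 //.
rewrite -natrX -natrM -natrD ler_nat; apply: leq_trans (fm n) _.
apply: leq_trans (leq_addr _ _); apply: leq_mul => //.
by case: m {fm} => // m; rewrite leq_exp2r //; nia.
Qed.

(** If f were at most of order n^a with a < m, then n^(m - a) would be bounded by a constant E. *)
Lemma growth_exponent_ge f m : eventual_lower (fun n => n ^ m)%N f ->
  (m%:R%:E <= growth_exponent (fun n => (f n)%:R : R))%E.
Proof.
case=> A H; rewrite leNgt; apply/negP => /ereal_inf_lt [_ [a [a0 [B HB]] <-]].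
rewrite lte_fin => am.
(* For n >= 1 the argument B * (A * n + A) + B is at most D * n. *)
pose D : R := (B * (A + A) + B)%N%:R.
pose E : R := A%:R * (B%:R * D `^ a + B%:R) + A%:R.
have E0 : 0 <= E by rewrite addr_ge0 // mulr_ge0 // addr_ge0 // mulr_ge0 // powR_ge0.
have bound (n : nat) : (0 < n)%N -> n%:R `^ (m%:R - a) <= E.
  move=> n0; have nR : 0 < n%:R :> R by rewrite ltr0n.
  have na : 0 < n%:R `^ a :> R by exact: powR_gt0.
  have na1 : 1 <= n%:R `^ a :> R.
    by have := ge0_ler_powR a0 (x := 1) (y := n%:R); rewrite powR1 !nnegrE ler01 ler0n ler1n; apply.
  rewrite -(ler_pM2r na) -powRD; last by apply/implyP => _; rewrite gt_eqF.
  rewrite subrK powR_mulrn ?ler0n // -natrX.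
  have := H n (A * n + A)%N (leqnn _); rewrite -(ler_nat R) natrD natrM.
  move=> /le_trans; apply.
  have := HB (A * n + A)%N; rewrite !ger0_norm ?powR_ge0 ?ler0n // => fB.
  have Dn : (B * (A * n + A) + B)%:R `^ a <= D `^ a * n%:R `^ a :> R.
    rewrite -powRM ?ler0n // ge0_ler_powR ?nnegrE ?ler0n ?mulr_ge0 ?ler0n //.
    by rewrite /D -natrM ler_nat; nia.
  have {fB Dn} fB : (f (A * n + A))%:R <= B%:R * (D `^ a * n%:R `^ a) + B%:R :> R.
    by apply: le_trans fB _; rewrite lerD2r ler_wpM2l ?ler0n.
  apply: le_trans (_ : A%:R * (B%:R * (D `^ a * n%:R `^ a) + B%:R) + A%:R <= _).
    by rewrite lerD2r ler_wpM2l ?ler0n.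
  rewrite /E mulrDl lerD //; last by rewrite ler_peMr ?ler0n.
  rewrite -mulrA ler_wpM2l ?ler0n // mulrDl -mulrA lerD2l.
  by rewrite ler_peMr ?ler0n.
pose eps := m%:R - a; have eps0 : 0 < eps by rewrite subr_gt0.
(* N exceeds E^(1/eps), so N^eps > E. *)
pose N := (Num.trunc (E `^ eps^-1)).+1.
have := bound N isT; apply/negP; rewrite -ltNge -/eps.
have {1}-> : E = (E `^ eps^-1) `^ eps.
  by rewrite -powRrM mulVf ?gt_eqF // powRr1.
by apply: gt0_ltr_powR; rewrite ?nnegrE ?powR_ge0 ?ler0n //; exact: truncnS_gt.
Qed.
End Asymptotics.

Theorem theorem4 (R : realType) (k : nat) (hk : (2 <= k)%N)
    (S1 : finType) (R1 : seq (free_group S1))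
    (h1 : presents R1 (Gamma (2 * k) (2 * k - 1)))
    (S2 : finType) (R2 : seq (free_group S2))
    (h2 : presents R2 (Gamma (2 * k + 1) (2 * k))) :
  [/\ asymp (fun n => (cent_dehn R1 n)%:R : R) (fun n => (cent_dehn R2 n)%:R),
      asymp (fun n => (cent_dehn R2 n)%:R : R) (fun n => n%:R ^+ (2 * k - 1)) &
      growth_exponent (fun n => (dehn R2 n)%:R : R)
        <> growth_exponent (fun n => (cent_dehn R2 n)%:R : R)].
Proof.
(* With j = 2k-4, (e, e') is (j+2, j+1) for the first group and (j+3, j+2) for the second. Both
   upper bounds use d = j+2, and both centralised lower bounds use the odd degree j+1; each gives
   the exponent j+3 = 2k-1. *)
set j := (2 * k - 4)%N.
have k2 : (2 * k = j.+2.+2)%N by rewrite /j; lia.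
have k1 : (2 * k - 1 = j.+3)%N by rewrite /j; lia.
have k3 : (2 * k + 1 = j.+3.+2)%N by rewrite /j; lia.
have odd_j : odd j.+1 by rewrite /j; lia.
rewrite k1 in h1 *; rewrite k2 in h1; rewrite k3 k2 in h2.
have [C1 up1] := cent_dehn_upper h1 (isT : 0 < j.+2)%N (isT : 0 < j.+1)%N
  (isT : 0 < j.+2)%N (leqnSn _) (leq_addr _ _).
have [C2 up2] : exists C, forall n, (cent_dehn R2 n <= C * n ^ j.+3)%N.
  apply: (cent_dehn_upper h2 (d := j.+2)) => //.
  (* Here e = j+3 = d+1, which is admissible because e is odd. *)
  by rewrite (_ : odd j.+3) ?addn1 // -[odd _]/(~~ ~~ odd j.+1) negbK.
have low1 := cent_dehn_lower h1 odd_j (leqnn _).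
have low2 := cent_dehn_lower h2 odd_j (leqnSn _).
have low := dehn_lower h2 isT.
have pow_nat : (fun n => n%:R ^+ j.+3 : R) = (fun n => (n ^ j.+3)%N%:R).
  by apply/funext => n; rewrite natrX.
split.
- by split; [exact: preceq_lower_upper up1 low2|exact: preceq_lower_upper up2 low1].
- rewrite pow_nat; split; last exact: preceq_lower.
  apply: (@preceq_nat _ _ _ C2.+1) => n; apply: leq_trans (up2 n) (leq_trans _ (leq_addr _ _)).
  by apply: leq_mul => //; rewrite leq_exp2r //; nia.
(* The exponent is at least j+4 = 2k for the Dehn function and at most j+3 for the centralised
   one. *)
move=> growth_eq; have := growth_exponent_le R up2.
rewrite -growth_eq => /(le_trans (growth_exponent_ge R low)).
by rewrite lee_fin ler_nat ltnn.
Qed.
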